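(* Let $\beta=1$ and $F\in\mathcal{G}_\alpha$ with $\alpha>0$. Then for any $\delta>0$, $$\lim_{k\to\infty}\frac{T_k}{k^{2-\delta}}=\infty\quad\text{and}\quad\lim_{k\to\infty}\frac{T_k}{k^{2+\delta}}=0\qquad\text{a.s.}$$
   Context: Selection rule. $X_1,X_2,\ldots$ are i.i.d. with a common absolutely continuous distribution function $F$ such that $1-F(x)>0$ for all $x<\infty$. For fixed $\beta\ge1$, set $T_1=1$, $Y_1=X_1$, and inductively $T_{k+1}=\inf\{i>T_k: X_i>\beta\overline{Y}_k\}$, $Y_{k+1}=X_{T_{k+1}}$, where $\overline{Y}_k=\frac1k\sum_{j=1}^kY_j$. Thus $T_k$ is the number of observations inspected until the $k$th item is retained. VM distribution. Let $x_F=\sup\{x:F(x)<1\}$. $F$, belonging to the domain of attraction of the Gumbel extreme value distribution $\exp\{-e^{-x}\}$, is a Von Mises function (VM) if there exist $x_0$ and $r>0$ such that for $x_0<x<x_F$, $1-F(x)=r\exp\{-\int_{x_0}^x[1/f_A(u)]\,du\}=:e^{-H(x)}$, where $f_A>0$ on $(x_0,x_F)$, $f_A$ is absolutely continuous on $(x_0,x_F)$ with derivative $f_A'$, and $\lim_{u\nearrow x_F}f_A'(u)=0$. Only VM distributions with $x_F=\infty$ are considered. Class $\mathcal{G}_\alpha$ ($\alpha>0$). $F\in\mathcal{G}_\alpha$ (generalized stretched exponential) if $F$ is VM and $H(x)=x^\alpha+h(x)$ for $x>x_0$, where $h''$ exists, $\lim_{x\to\infty}h(x)/x^\alpha=0$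 and $\lim_{x\to\infty}h'(x)/x^{\alpha-1}=0$. *)

(* Defs.v *)
From HB Require Import structures.
From mathcomp Require Export all_boot all_order all_algebra.
From mathcomp Require Export finmap.
From mathcomp Require Export all_classical all_reals all_analysis.
Export Order.TTheory GRing.Theory Num.Theory.
Export numFieldNormedType.Exports.

#[export] Set Implicit Arguments.
#[export] Unset Strict Implicit.
#[export] Unset Printing Implicit Defensive.

Local Open Scope classical_set_scope.
Local Open Scope ring_scope.

(* Mutual independence of the subfamily (X_i), i in I. *)
Definition independent_RVs (d : measure_display) (T : measurableType d)
    (R : realType) (P : probability T R) (I : set nat)
    (X : nat -> {RV P >-> R}) : Prop :=
  forall (J : {fset nat}) (A : nat -> set R),
    [set` J] `<=` I -> (forall i, measurable (A i)) ->
    P (\bigcap_(i in [set` J]) (X i @^-1` A i)) =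
      (\prod_(i <- J) P (X i @^-1` A i))%E.

Definition abs_continuous_on (R : realType) (D : set R) (f : R -> R) : Prop :=
  forall e : R, 0 < e -> exists2 d : R, 0 < d &
    forall (n : nat) (a b : 'I_n -> R),
      (forall i, a i <= b i) ->
      (forall i, `[a i, b i] `<=` D) ->
      trivIset [set: 'I_n] (fun i => `]a i, b i[%classic) ->
      \sum_(i < n) (b i - a i) < d ->
      \sum_(i < n) `|f (b i) - f (a i)| < e.

Definition gumbel_domain (R : realType) (F : R -> R) : Prop :=
  exists (a b : nat -> R), (forall n, 0 < a n) /\
    forall x : R, F (a n * x + b n) ^+ n @[n --> \oo] --> expR (- expR (- x)).

(* Von Mises functions with right endpoint +oo, represented on ]x0, +oo[.
   An absolutely continuous fA has a derivative only almost everywhere: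
   dfA is a version of it.  Absolute continuity on the open half-line is
   meant on its compact subintervals. *)
Definition von_mises (R : realType) (F : R -> R) (x0 : R) : Prop :=
  gumbel_domain F /\
  exists (r : R) (fA dfA : R -> R),
    0 < r /\
    [/\ forall x, x0 < x -> 0 < fA x,
        forall a b, x0 < a -> abs_continuous_on `[a, b] fA,
        {ae @lebesgue_measure R, forall x, x0 < x -> is_derive x 1 fA (dfA x)},
        dfA u @[u --> +oo] --> 0 &
        forall x, x0 < x ->
          (@lebesgue_measure R).-integrable `]x0, x]
            (fun u => ((fA u)^-1)%:E) /\
          1 - F x =
            r * expR (- \int[@lebesgue_measure R]_(u in `]x0, x]) (fA u)^-1)].

(* H in the writing 1 - F = e^{-H} *)
Definition cum_hazard (R : realType) (F : R -> R) (x : R) : R :=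
  - ln (1 - F x).

(* The condition 0 <= x0 only makes x ^ alpha meaningful on ]x0, +oo[; x0 may
   always be increased. *)
Definition gen_stretched_exp (R : realType) (alpha : R) (F : R -> R) : Prop :=
  exists2 x0 : R, 0 <= x0 & von_mises F x0 /\
  exists h : R -> R,
    [/\ forall x, x0 < x -> cum_hazard F x = x `^ alpha + h x,
        forall x, x0 < x -> derivable h x 1 /\ derivable (derive1 h) x 1,
        h x / x `^ alpha @[x --> +oo] --> 0 &
        derive1 h x / x `^ (alpha - 1) @[x --> +oo] --> 0].

(* inf {i > m : x_i > c}, None standing for inf of the empty set *)
Definition first_exceedance (R : realType) (x : nat -> R) (m : nat) (c : R) :
    option nat :=
  if pselect (exists i, (m < i)%N && (c < x i)) is left ex
  then Some (ex_minn ex) else None.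

(* (T_k, Y_1 + ... + Y_k) along a path x_1, x_2, ... (x_0 is ignored), or None
   if fewer than k items are ever retained. *)
Fixpoint retained (R : realType) (beta : R) (x : nat -> R) (k : nat) :
    option (nat * R) :=
  match k with
  | 0 => Some (0%N, 0)
  | k'.+1 =>
    if k' is 0 then Some (1%N, x 1%N) else
    if retained beta x k' is Some (t, s) then
      if first_exceedance x t (beta * (s / k'%:R)) is Some t'
      then Some (t', s + x t') else None
    else None
  end.

Definition retention_time (R : realType) (beta : R) (x : nat -> R) (k : nat) :
    \bar R :=
  if retained beta x k is Some (t, _) then (t%:R)%:E else +oo%E.

(* Main.v *)
(* Only counts of exceedances are needed.  Let [H = - ln (1 - F)], and let [m]
   be the mean of the [k] items kept so far at time [n].  All items kept after
   that time exceed [m], and every item exceeding a later mean is kept.  By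
   Chebyshev and Borel-Cantelli, almost surely, at all late times of a
   geometric grid of ratio [1 + 1/M], the number of [i <= n] with
   [H (X i) > a/M] is [n exp (- a/M)] up to a factor [ln n ^ 2] times its square
   root, for all relevant [a]; the rest is pathwise.

   In the class G_alpha the rescaled excess [(X - m) H' m] over a high level is
   nearly exponential.  Hence in a block of time of the grid during which many
   items exceed the mean, [k dm] is close to [dk / H' m], i.e. [d (H m)] is
   close to [d (ln k)].  Blocks with few exceedances need care: when the mean is
   that high, [H m] is about [ln n], which is enough for the lower bound on
   [H m] since [k <= n]; for the upper bound, few items are kept in all these
   blocks together, and they contribute [o (ln n)].  So [H m / ln k] tends to 1.
   As [k] is at least about [n exp (- H m)] and [dk] is at most about
   [exp (- H m) dn], [k] is [n ^ (1/2 + o(1))]. *)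
Require Import Defs.
From mathcomp Require Import ring lra zify measurable_realfun.
Local Open Scope classical_set_scope.
Local Open Scope ring_scope.

(** * Excesses over a high level *)

(** The mean depends on the sample, so no concentration bound applies at the mean itself. Counts are
    controlled at deterministic levels [y a] with [H (y a) = a / M], simultaneously for all
    [0 < a <= j ^ 2] at the [j]-th grid time, and the mean is sandwiched between adjacent levels.
    Sums of excesses reduce to such counts by a discrete layer-cake formula. One fixed [eps = 1 / M]
    is the ratio of the time grid, the spacing of the levels and the tolerance in the exponential
    approximation, so main terms are kept up to factors [1 + O(eps)]. The final exponents are off by
    at most [23 eps], which [46 eps <= delta] absorbs; [M] never tends to infinity. The obstacle is
    that [n exp (- H m)] cannot be kept above a power of [ln n] a priori, and below that size
    fluctuations dominate a block. Hence the dichotomy in [block_facts]: either the increment of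
    [H m] follows that of [ln k], or [n exp (- H m)] is at most polynomial in [j], that is in
    [ln n]. *)

Section analytic.
Variable R : realType.

Lemma ln_le (a b : R) : 0 < a -> a <= b -> ln a <= ln b.
Proof. by move=> a0 ab; rewrite ler_ln// posrE; exact: lt_le_trans ab. Qed.

Lemma le_of_derive_ge0 (f df : R -> R) (m x : R) : m <= x ->
  (forall t, m <= t -> is_derive t 1 f (df t)) ->
  (forall t, m <= t -> 0 <= df t) -> f m <= f x.
Proof.
move=> mx fd df0.
have [t||c] := @MVT_segment R f df m x mx.
- by rewrite in_itv/= => /andP[/ltW mt _]; exact: fd.
- apply: derivable_within_continuous => t.
  by rewrite in_itv/= => /andP[mt _]; case: (fd _ mt).
- rewrite in_itv/= => /andP[mc _] e.
  by rewrite -subr_ge0 e mulr_ge0 ?df0 ?subr_ge0.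
Qed.

(* [H'] is comparable to [t ^ (alpha - 1)], a power of [t], while [exp (eps H)]
   grows faster than any power of [t]; this controls [H' t / H' m] uniformly in
   [t >= m] by [exp (eps (H t - H m))]. *)
Lemma excess_bounds (H dH : R -> R) (x0 alpha eps : R) :
  0 < alpha -> 0 < eps < 1 ->
  (forall t, x0 < t -> is_derive t 1 H (dH t)) ->
  (dH t / t `^ (alpha - 1)) @[t --> +oo] --> alpha ->
  exists m0 : R, forall m x, m0 <= m -> m <= x ->
  [/\ 0 < alpha * m `^ (alpha - 1),
     (x - m) * (alpha * m `^ (alpha - 1)) <=
       (1 + eps) * ((expR (eps * (H x - H m)) - 1) / eps) &
     (1 - eps) * ((1 - expR (- (eps * (H x - H m)))) / eps) <=
     (x - m) * (alpha * m `^ (alpha - 1))].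
Proof.
move=> a0 /andP[e0 e1] Hd cvgd.
(* The margin [eps / 4] is chosen for the two products met at the end:
   [(1 + eps) (1 - eps / 4) >= 1] and [(1 - eps) (1 + eps / 4) <= 1]. *)
have ae0 : 0 < alpha * eps / 4 by rewrite !mulr_gt0 ?invr_gt0.
have /cvgrPdist_le/(_ _ ae0)[m1 [_ hm1]] := cvgd.
(* [t ^ alpha >= B] says that [|alpha - 1| / t] is at most half of [eps alpha t ^ (alpha - 1)],
   hence at most [eps H' t]. *)
pose B := 2 * `|alpha - 1| / (eps * alpha).
have B0 : 0 <= B by rewrite /B divr_ge0 ?mulr_ge0// ltW.
pose m0 := Num.max 1 (Num.max (x0 + 1) (Num.max (m1 + 1) (B `^ alpha^-1))).
exists m0 => m x; rewrite /m0 !ge_max => /and4P[m_ge1 mx0 mm1 mB] mx.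
have tP t : m <= t -> [/\ 0 < t, x0 < t, B <= t `^ alpha,
   (1 - eps / 4) * (alpha * t `^ (alpha - 1)) <= dH t &
   dH t <= (1 + eps / 4) * (alpha * t `^ (alpha - 1))].
  move=> mt.
  have t0 : 0 < t by lra.
  have p0 : 0 < t `^ (alpha - 1) by rewrite powR_gt0.
  have tm1 : m1 < t by lra.
  have := hm1 _ tm1; rewrite ler_distlC => /andP[h1 h2].
  have e : dH t = dH t / t `^ (alpha - 1) * t `^ (alpha - 1).
    by rewrite divfK// gt_eqF.
  split => //; first lra.
  - apply: (@le_trans _ _ ((B `^ alpha^-1) `^ alpha)).
      by rewrite -powRrM mulVf ?gt_eqF// powRr1.
    apply: ge0_ler_powR; [exact: ltW|by rewrite nnegrE powR_ge0| |exact: le_trans mt].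
    by rewrite nnegrE ltW.
  - rewrite e mulrA ler_pM2r//; lra.
  - rewrite e mulrA ler_pM2r//; lra.
have m_gt0 : 0 < m by lra.
have c0 : 0 < alpha * m `^ (alpha - 1) by rewrite mulr_gt0// powR_gt0.
have lnle t : m <= t -> `|alpha - 1| * (ln t - ln m) <= eps * (H t - H m).
  move=> mt.
  suff : eps * H m - `|alpha - 1| * ln m <= eps * H t - `|alpha - 1| * ln t.
    by rewrite !mulrBr; lra.
  apply: (@le_of_derive_ge0 (fun t => eps * H t - `|alpha - 1| * ln t)
    (fun t => eps * dH t - `|alpha - 1| * t^-1) m t mt).
  - move=> s /tP[s0 xs _ _ _]; have ? := Hd s xs; have ? := is_derive1_ln s0.
    apply: is_deriveB.
  - move=> s /tP[s0 xs Bs ds _]; rewrite subr_ge0 ler_pdivrMr//.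
    have Hs : eps * (alpha / 2 * s `^ (alpha - 1)) * s <= eps * dH s * s.
      rewrite ler_pM2r// ler_pM2l//; apply: le_trans ds.
      have := mulr_gt0 a0 (powR_gt0 (alpha - 1) s0); set q := s `^ _; nra.
    apply: le_trans Hs.
    have -> : eps * (alpha / 2 * s `^ (alpha - 1)) * s =
      eps * alpha / 2 * (s * s `^ (alpha - 1)) by lra.
    rewrite mulr_powRB1 ?(ltW s0)//.
    have -> : `|alpha - 1| = eps * alpha / 2 * B.
      by rewrite /B; field; rewrite !gt_eqF.
    by rewrite ler_pM2l// !mulr_gt0.
have pw t : m <= t -> t `^ (alpha - 1) = m `^ (alpha - 1) *
   expR ((alpha - 1) * (ln t - ln m)).
  move=> mt; have t0 : 0 < t by lra.
  rewrite /powR !gt_eqF// -expRD; congr expR; lra.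
have pw1 t : m <= t -> m `^ (alpha - 1) <= t `^ (alpha - 1) * expR (eps * (H t - H m)).
  move=> mt; rewrite (pw t)// -mulrA -expRD ler_peMr ?powR_ge0//.
  rewrite -[leLHS]expR0 ler_expR.
  have l0 : 0 <= ln t - ln m by rewrite subr_ge0 ln_le.
  have := lnle _ mt; have := ler_wpM2r l0 (ler_norm (- (alpha - 1))).
  by rewrite normrN; nra.
have pw2 t : m <= t -> t `^ (alpha - 1) * expR (- (eps * (H t - H m))) <= m `^ (alpha - 1).
  move=> mt; rewrite (pw t)// -mulrA -expRD ler_piMr ?powR_ge0//.
  rewrite -[leRHS]expR0 ler_expR.
  have l0 : 0 <= ln t - ln m by rewrite subr_ge0 ln_le.
  have := lnle _ mt; have := ler_wpM2r l0 (ler_norm (alpha - 1)); nra.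
have dE t : m <= t -> is_derive t 1 (fun t => eps * (H t - H m)) (eps * dH t).
  move=> /tP[s0 xs _ _ _]; have ? := Hd t xs.
  have h1 : is_derive t 1 (fun t => H t - H m) (dH t).
    by apply: is_derive_eq; rewrite subr0.
  by apply: is_derive_eq.
split => //.
(* By [pw1], [c <= (1 + eps) H' t exp (eps (H t - H m))]. The factor [H' t] makes the right side an
   exact derivative, so monotonicity of the difference replaces an integration from [m] to [x]. *)
- pose c := alpha * m `^ (alpha - 1).
  have := @le_of_derive_ge0 (fun t => (1 + eps) / eps * expR (eps * (H t - H m)) - c * t)
   (fun t => (1 + eps) / eps * (eps * dH t * expR (eps * (H t - H m))) - c) m x mx.
  rewrite subrr mulr0 expR0 mulr1 -/c => h.
  suff : (1 + eps) / eps - c * m <= (1 + eps) / eps * expR (eps * (H x - H m)) - c * x.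
    rewrite (_ : (x - m) * c = c * x - c * m); last by ring.
    rewrite (_ : (1 + eps) * ((expR (eps * (H x - H m)) - 1) / eps) = (1 + eps) / eps * expR (eps * (H x - H m)) - (1 + eps) / eps); last by ring.
    lra.
  apply: h => t mt.
    have ? := dE t mt.
    apply: is_derive_eq.
    by rewrite /GRing.scale/= mulr1; ring.
  have [_ _ _ + _] := tP _ mt.
  have := pw1 _ mt; rewrite subr_ge0 (_ : _ / _ * _ = (1 + eps) * (dH t * expR (eps * (H t - H m)))); last first.
    by field; rewrite gt_eqF.
  have := expR_gt0 (eps * (H t - H m)); set E := expR _ => E0.
  rewrite -/c in c0 *; set q := t `^ _; set p := m `^ _ in c c0 * => pq dq.
  apply: (@le_trans _ _ ((1 + eps) * ((1 - eps / 4) * (alpha * q) * E))).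
    have : alpha * p <= alpha * (q * E) by rewrite ler_pM2l.
    have : 0 < alpha * (q * E) by rewrite !mulr_gt0// powR_gt0//; lra.
    rewrite /c; set z := alpha * (q * E).
    rewrite (_ : (1 + eps) * _ = (1 + eps) * (1 - eps / 4) * z); last by rewrite /z; ring.
    by move=> z0 /le_trans; apply; rewrite ler_peMl ?(ltW z0)//; nra.
  by rewrite ler_pM2l; [rewrite ler_pM2r|lra].
- pose c := alpha * m `^ (alpha - 1).
  have := @le_of_derive_ge0 (fun t => c * t + (1 - eps) / eps * expR (- (eps * (H t - H m))))
   (fun t => c - (1 - eps) / eps * (eps * dH t * expR (- (eps * (H t - H m))))) m x mx.
  rewrite subrr mulr0 oppr0 expR0 mulr1 -/c => h.
  suff : c * m + (1 - eps) / eps <= c * x + (1 - eps) / eps * expR (- (eps * (H x - H m))).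
    rewrite (_ : (x - m) * c = c * x - c * m); last by ring.
    rewrite (_ : (1 - eps) * ((1 - expR (- (eps * (H x - H m)))) / eps) = (1 - eps) / eps - (1 - eps) / eps * expR (- (eps * (H x - H m)))); last by ring.
    lra.
  apply: h => t mt.
    have ? := dE t mt.
    apply: is_derive_eq.
    by rewrite /GRing.scale/= mulr1; ring.
  have [_ _ _ _] := tP _ mt.
  have := pw2 _ mt; rewrite subr_ge0 (_ : _ / _ * _ = (1 - eps) * (dH t * expR (- (eps * (H t - H m))))); last first.
    by field; rewrite gt_eqF.
  have := expR_gt0 (- (eps * (H t - H m))); set E := expR _ => E0.
  rewrite -/c in c0 *; set q := t `^ _; set p := m `^ _ in c c0 * => pq dq.
  apply: (@le_trans _ _ ((1 - eps) * ((1 + eps / 4) * (alpha * q) * E))).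
    by rewrite ler_pM2l; [rewrite ler_pM2r|lra].
  have : alpha * (q * E) <= alpha * p by rewrite ler_pM2l.
  have : 0 < alpha * (q * E) by rewrite !mulr_gt0// powR_gt0//; lra.
  rewrite /c; set z := alpha * (q * E).
  rewrite (_ : (1 - eps) * _ = (1 - eps) * (1 + eps / 4) * z); last by rewrite /z; ring.
  by move=> z0; apply: le_trans; rewrite ler_piMl ?(ltW z0)//; nra.
Qed.
End analytic.

(** * The retention process *)

Section process.
Context {R : realType}.
Implicit Types x : nat -> R.

(** The selection rule for [beta = 1], run by observation time instead of by number of retained
    items, which makes it total. As in [retained], [x 0] is ignored and the first item is kept
    unconditionally. *)
Fixpoint kept_state x (n : nat) : nat * R :=
  if n is n'.+1 then
    let: (k, s) := kept_state x n' in
    if (k == 0%N) || (s / k%:R < x n) then (k.+1, s + x n) else (k, s)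
  else (0%N, 0).

Definition kept x n : nat := (kept_state x n).1.
Definition kept_mean x n : R := (kept_state x n).2 / (kept x n)%:R.

Lemma keptS x n : kept_state x n.+1 =
  if (kept x n == 0%N) || (kept_mean x n < x n.+1)
  then ((kept x n).+1, (kept_state x n).2 + x n.+1) else kept_state x n.
Proof. by rewrite /kept_mean /kept /=; case: (kept_state x n). Qed.

Lemma kept_gt0 x n : (0 < n)%N -> (0 < kept x n)%N.
Proof.
case: n => // n _; rewrite /kept keptS; case: ifP => //=.
by move=> /negbT; rewrite negb_or -lt0n => /andP[].
Qed.

Lemma kept_sumE x n : (0 < n)%N ->
  (kept_state x n).2 = (kept x n)%:R * kept_mean x n.
Proof.
by move=> /(kept_gt0 x) k0; rewrite /kept_mean mulrC divfK// pnatr_eq0 -lt0n.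
Qed.

Lemma kept_nondecr x n n' : (n <= n')%N -> (kept x n <= kept x n')%N.
Proof.
elim: n' => [|n' IH]; first by rewrite leqn0 => /eqP ->.
rewrite leq_eqVlt => /predU1P[->//|]; rewrite ltnS => /IH /leq_trans; apply.
by rewrite /kept keptS; case: ifP.
Qed.

Lemma kept_le x n : (kept x n <= n)%N.
Proof.
by elim: n => // n IH; rewrite /kept keptS; case: ifP => _ //=; rewrite ltnW.
Qed.

(* The mean moves towards the new item. *)
Lemma kept_meanS x n : (0 < n)%N -> kept_mean x n < x n.+1 ->
  [/\ kept x n.+1 = (kept x n).+1,
      kept_mean x n <= kept_mean x n.+1,
      kept_mean x n.+1 <= x n.+1 &
      (kept x n.+1)%:R * (kept_mean x n.+1 - kept_mean x n) =
      x n.+1 - kept_mean x n].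
Proof.
move=> n0 mx; have eS := keptS x n; rewrite mx orbT in eS.
have kS : kept x n.+1 = (kept x n).+1 by rewrite /kept eS.
have e2 := kept_sumE x (ltn0Sn n); rewrite eS /= kS kept_sumE// -natr1 in e2.
have kR : 0 < (kept x n)%:R :> R by rewrite ltr0n kept_gt0.
rewrite kS -natr1; move: e2.
set k := (kept x n)%:R in kR *; set m := kept_mean x n in mx *.
set m' := kept_mean x n.+1; move=> e2.
have e3 : (k + 1) * (m' - m) = x n.+1 - m by lra.
by split=> //; nra.
Qed.

Lemma kept_mean_const x n : (0 < n)%N -> x n.+1 <= kept_mean x n ->
  kept x n.+1 = kept x n /\ kept_mean x n.+1 = kept_mean x n.
Proof.
move=> n0 xm; have eS : kept_state x n.+1 = kept_state x n.
  by rewrite keptS gtn_eqF ?kept_gt0// ltNge xm.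
have kS : kept x n.+1 = kept x n by rewrite /kept eS.
by rewrite {1}/kept_mean eS kS.
Qed.

Lemma kept_mean_nondecr x n n' : (0 < n)%N -> (n <= n')%N ->
  kept_mean x n <= kept_mean x n'.
Proof.
move=> n0; elim: n' => [|n' IH]; first by rewrite leqn0 => /eqP ->.
rewrite leq_eqVlt => /predU1P[->//|]; rewrite ltnS => nn'.
apply: (le_trans (IH nn')); have n'0 := leq_trans n0 nn'.
have [h|h] := ltP (kept_mean x n') (x n'.+1).
  by have [] := kept_meanS n'0 h.
by have [_ ->] := kept_mean_const n'0 h.
Qed.

(** Means never decrease, so every item kept in the block beats the mean at its start. *)
Lemma kept_block_le x n n' : (0 < n)%N -> (n <= n')%N ->
  (kept x n' <= kept x n +
     \sum_(n.+1 <= i < n'.+1) (kept_mean x n < x i)%R)%N.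
Proof.
move=> n0; elim: n' => [|n' IH]; first by rewrite leqn0 => /eqP ->; lia.
rewrite leq_eqVlt => /predU1P[->|]; first exact: leq_addr.
rewrite ltnS => nn'; rewrite big_nat_recr//= addnA.
have n'0 := leq_trans n0 nn'; have mm := kept_mean_nondecr x n0 nn'.
have [h|h] := ltP (kept_mean x n') (x n'.+1).
  have [-> _ _ _] := kept_meanS n'0 h.
  by rewrite (le_lt_trans mm h) addn1 ltnS IH.
have [-> _] := kept_mean_const n'0 h.
by rewrite (leq_trans (IH nn'))// leq_addr.
Qed.

(** An item above the final mean also beats the mean at its own inspection. The slack [M] leaves
    room for a grid level. *)
Lemma kept_block_ge x n n' (M : R) : (0 < n)%N -> (n <= n')%N ->
  kept_mean x n' <= M ->
  (kept x n + \sum_(n.+1 <= i < n'.+1) (M < x i)%R <= kept x n')%N.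
Proof.
move=> n0; elim: n' => [|n' IH]; first by rewrite leqn0 => /eqP nE; lia.
rewrite leq_eqVlt => /predU1P[->|]; first by rewrite big_geq// addn0.
rewrite ltnS => nn' mM; rewrite big_nat_recr//= addnA.
have n'0 := leq_trans n0 nn'.
have mM' := le_trans (kept_mean_nondecr x n'0 (leqnSn n')) mM.
have [h|h] := ltP (kept_mean x n') (x n'.+1).
  have [-> _ _ _] := kept_meanS n'0 h.
  by have := IH nn' mM'; case: (M < _)%R; lia.
have [-> _] := kept_mean_const n'0 h.
by rewrite ltNge (le_trans h mM') addn0 IH.
Qed.

Lemma kept_ge x n (M : R) : (0 < n)%N -> kept_mean x n <= M ->
  (\sum_(1 <= i < n.+1) (M < x i)%R <= kept x n)%N.
Proof.
(* The block starts at time 1; the first item is kept in any case, which pays for the summand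
   [i = 1]. *)
move=> n0 mM; have := kept_block_ge (leqnn 1) n0 mM.
rewrite [in X in _ -> X]big_ltn ?ltnS//; apply: leq_trans.
by rewrite leq_add2r; apply: (@leq_trans 1%N) (kept_gt0 x _) => //; case: (M < _)%R.
Qed.

(** Both sides are sums of [X - mu] over the kept items. With [mu] the mean at the start of a block,
    this is the total excess gained in the block. *)
Lemma kept_mean_step x n mu : (0 < n)%N -> kept_mean x n < x n.+1 ->
  (kept x n.+1)%:R * (kept_mean x n.+1 - mu) =
  (kept x n)%:R * (kept_mean x n - mu) + (x n.+1 - mu).
Proof.
move=> n0 h; have [-> _ _ ] := kept_meanS n0 h; rewrite -natr1 => e.
have -> : x n.+1 - mu = x n.+1 - kept_mean x n + (kept_mean x n - mu) by ring.
by rewrite -e; ring.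
Qed.

(** As [phi] is nonnegative it may be summed over all items, kept or not: a sum over a random
    selection becomes a sum of functions of single observations. *)
Lemma excess_block_le x n n' (phi : R -> R) : (0 < n)%N -> (n <= n')%N ->
  (forall v, 0 <= phi v) ->
  (forall i, (n < i <= n')%N -> kept_mean x n < x i ->
    x i - kept_mean x n <= phi (x i)) ->
  (kept x n')%:R * (kept_mean x n' - kept_mean x n) <=
  \sum_(n.+1 <= i < n'.+1) phi (x i).
Proof.
move=> n0 + phi0; elim: n' => [|n' IH].
  by rewrite leqn0 => /eqP nE; rewrite nE in n0.
rewrite leq_eqVlt => /predU1P[<-|].
  by rewrite big_geq// subrr mulr0.
rewrite ltnS => nn' phige; rewrite big_nat_recr//=.
have {}IH : (kept x n')%:R * (kept_mean x n' - kept_mean x n) <=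
    \sum_(n.+1 <= i < n'.+1) phi (x i).
  by apply: IH => // i /andP[ni ni']; apply: phige; rewrite ni ltnW.
have n'0 := leq_trans n0 nn'; have mm := kept_mean_nondecr x n0 nn'.
have [h|h] := ltP (kept_mean x n') (x n'.+1).
  by rewrite kept_mean_step// lerD// phige ?(le_lt_trans mm)// ltnS nn' leqnn.
have [-> ->] := kept_mean_const n'0 h.
by rewrite (le_trans IH)// lerDl.
Qed.

(** Items up to [M] may or may not be kept, but a kept one has nonnegative excess, so [phi <= 0] is
    enough there; items above [M] are all kept. *)
Lemma excess_block_ge x n n' (M : R) (phi : R -> R) : (0 < n)%N -> (n <= n')%N ->
  kept_mean x n' <= M ->
  (forall v, v <= M -> phi v <= 0) ->
  (forall v, M < v -> phi v <= v - kept_mean x n) ->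
  \sum_(n.+1 <= i < n'.+1) phi (x i) <=
  (kept x n')%:R * (kept_mean x n' - kept_mean x n).
Proof.
move=> n0 + + phi0 phile; elim: n' => [|n' IH].
  by rewrite leqn0 => /eqP nE; rewrite nE in n0.
rewrite leq_eqVlt => /predU1P[<-|].
  by rewrite big_geq// subrr mulr0.
rewrite ltnS => nn' mM; rewrite big_nat_recr//=.
have n'0 := leq_trans n0 nn'; have mm := kept_mean_nondecr x n0 nn'.
have mM' := le_trans (kept_mean_nondecr x n'0 (leqnSn n')) mM.
have [h|h] := ltP (kept_mean x n') (x n'.+1).
  rewrite kept_mean_step// lerD ?IH//.
  have [xM|xM] := leP (x n'.+1) M; last exact: phile.
  by rewrite (le_trans (phi0 _ xM))// subr_ge0 (le_trans mm)// ltW.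
have [-> ->] := kept_mean_const n'0 h.
by rewrite (le_trans _ (IH nn' mM'))// gerDl phi0// (le_trans h).
Qed.

Lemma excess_block_le_max x n n' (Y : R) : (0 < n)%N -> (n <= n')%N ->
  (forall i, (n < i <= n')%N -> x i <= Y) ->
  (kept x n')%:R * (kept_mean x n' - kept_mean x n) <=
  ((kept x n')%:R - (kept x n)%:R) * (Y - kept_mean x n).
Proof.
move=> n0; elim: n' => [|n' IH].
  by rewrite leqn0 => /eqP nE; rewrite nE in n0.
rewrite leq_eqVlt => /predU1P[<-|]; first by rewrite !subrr mulr0 mul0r.
rewrite ltnS => nn' xY.
have n'0 := leq_trans n0 nn'; have mm := kept_mean_nondecr x n0 nn'.
have {}IH : (kept x n')%:R * (kept_mean x n' - kept_mean x n) <=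
    ((kept x n')%:R - (kept x n)%:R) * (Y - kept_mean x n).
  by apply: IH => // i /andP[ni ni']; rewrite xY// ni ltnW// ltnS.
have [h|h] := ltP (kept_mean x n') (x n'.+1); last first.
  by have [-> ->] := kept_mean_const n'0 h.
rewrite kept_mean_step//; have [-> _ _ _] := kept_meanS n'0 h.
have := xY n'.+1; rewrite ltnS nn' leqnn => /(_ isT) ?.
by rewrite -natr1 addrAC mulrDl mul1r lerD// lerB.
Qed.

Lemma kept_mean_le x n (Y : R) : (0 < n)%N ->
  (forall i, (0 < i <= n)%N -> x i <= Y) -> kept_mean x n <= Y.
Proof.
elim: n => // -[_ _ xY|n IH _ xY].
  by rewrite /kept_mean /kept /= invr1 mulr1 add0r xY.
have {}IH : kept_mean x n.+1 <= Y.
  by apply: IH => // i /andP[i0 ni]; rewrite xY// i0 ltnW.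
have [h|h] := ltP (kept_mean x n.+1) (x n.+2).
  by have [_ _ h2 _] := kept_meanS (ltn0Sn n) h; rewrite (le_trans h2)// xY// leqnn.
by have [_ ->] := kept_mean_const (ltn0Sn n) h.
Qed.

Lemma kept_state_const x t n : (0 < t)%N -> (t <= n)%N ->
  (forall i, (t < i <= n)%N -> x i <= kept_mean x t) ->
  kept_state x n = kept_state x t.
Proof.
move=> t0; elim: n => [|n IH]; first by rewrite leqn0 => /eqP ->.
rewrite leq_eqVlt => /predU1P[->//|]; rewrite ltnS => tn xm.
have {}IH : kept_state x n = kept_state x t.
  by apply: IH => // i /andP[ti ni]; rewrite xm// ti ltnW.
rewrite keptS gtn_eqF ?kept_gt0//; last exact: leq_trans tn.
rewrite orFb {1}/kept_mean /kept IH ltNge -/(kept x t) -/(kept_mean x t).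
by rewrite xm// ltnS tn leqnn.
Qed.

(** Between two retentions the state is frozen, so the exceedance that [retained] searches for is
    the next increase of [kept]. The last conclusion makes [t] the first time with count [k], which
    serves to locate it in the time grid. *)
Lemma retained_kept x k n : (0 < k)%N -> (k <= kept x n)%N ->
  exists t s, [/\ retained 1 x k = Some (t, s), (0 < t <= n)%N,
    kept_state x t = (k, s) & forall i, (i < t)%N -> (kept x i < k)%N].
Proof.
elim: k => // -[_ _ kn|k IH _ kn].
  exists 1%N, (x 1%N); split=> //; last by case.
    by case: n kn.
  by rewrite /= add0r.
have [t [s [rt /andP[t0 tn] st kt]]] := IH isT (ltnW kn).
have ktE : kept x t = k.+1 by rewrite /kept st.
have mtE : kept_mean x t = s / k.+1%:R by rewrite /kept_mean ktE st.
rewrite /= -/(retained 1 x k.+1) rt mul1r -mtE /first_exceedance.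
(* Without a further exceedance the count would stay [k.+1] up to [n], against [kn]. *)
case: pselect => [ex|nex]; last first.
  have := kept_state_const t0 tn; rewrite /kept => e.
  move: kn; rewrite /kept e ?st/= ?ltnn// => i /andP[ti _].
  by rewrite leNgt; apply/negP => h; apply: nex; exists i; rewrite ti.
case: ex_minnP => t' /andP[tt' xt'] mint'.
case: t' => // t' in tt' xt' mint' *.
have cst l : (t <= l)%N -> (l <= t')%N -> kept_state x l = kept_state x t.
  move=> tl lt'; apply: kept_state_const => // i /andP[ti il].
  rewrite leNgt; apply/negP => h; have := mint' i; rewrite ti h => /(_ isT).
  by rewrite ltnNge (leq_trans il).
have kl l : (l <= t')%N -> (kept x l < k.+2)%N.
  move=> lt'; have [tl|/ltnW lt] := leqP t l.
    by rewrite /kept cst// st.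
  by rewrite ltnS (leq_trans (kept_nondecr x lt))// ktE.
exists t'.+1, (s + x t'.+1); split => //.
- have [//|nt'] := leqP t'.+1 n; rewrite ltnS in nt'.
  by have := kl _ nt'; rewrite ltnNge kn.
- have e : kept_state x t' = kept_state x t by exact: cst.
  have ke : kept x t' = kept x t by rewrite /kept e.
  have me : kept_mean x t' = kept_mean x t by rewrite /kept_mean e ke.
  by rewrite keptS me xt' orbT ke e st ktE.
Qed.
End process.

(** * One block of time *)

Section numeric.
Context {R : realType}.
Implicit Types t e : R.

Lemma expR_le_inv t : t < 1 -> expR t <= (1 - t)^-1.
Proof.
move=> t1; rewrite -[expR t]invrK lef_pV2 ?posrE ?invr_gt0 ?expR_gt0 ?subr_gt0//.
by rewrite -expRN; have := expR_ge1Dx (- t).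
Qed.

Lemma expRN_le t : 0 <= t -> expR (- t) <= (1 + t)^-1.
Proof.
move=> t0; rewrite expRN lef_pV2 ?posrE ?expR_gt0 ?ltr_wpDr//.
exact: expR_ge1Dx.
Qed.

Lemma geom_sum1 (q : R) n : q < 1 -> \sum_(s < n) q ^+ s = (1 - q ^+ n) / (1 - q).
Proof.
move=> q1; apply: (canRL (mulfK _)); first by rewrite subr_eq0 gt_eqF.
by rewrite mulrC -[1 - q]opprB mulNr -subrX1 opprB.
Qed.

Lemma geom_sum_le (q : R) n : 0 <= q < 1 -> \sum_(s < n) q ^+ s <= (1 - q)^-1.
Proof.
move=> /andP[q0 q1]; rewrite geom_sum1// ler_piMl ?invr_ge0 ?subr_ge0 ?(ltW q1)//.
by rewrite gerBl exprn_ge0.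
Qed.

Lemma expR_small t : 0 <= t -> 11 * t <= 1 -> expR t <= 1 + 11 / 10 * t.
Proof.
move=> t0 t1; apply: (le_trans (expR_le_inv _)); first lra.
rewrite -div1r ler_pdivrMr; nra.
Qed.

Lemma inv_expRN_le t : 0 < t -> (1 - expR (- t))^-1 <= (1 + t) / t.
Proof.
move=> t0; have h := expRN_le (ltW t0).
have e1 : expR (- t) < 1 by rewrite expR_lt1 oppr_lt0.
rewrite -div1r ler_pdivrMr ?subr_gt0// mulrAC ler_pdivlMr// mul1r.
have : expR (- t) * (1 + t) <= 1 by rewrite -ler_pdivlMr ?div1r//; lra.
lra.
Qed.

(** The constant of the layer-cake sum: layer [s] has weight [(exp (e^2) - 1) / e * exp (e^2 s)] and
    meets a count decaying like [exp (- th e s)], with [th = 1] for expected counts and [th = 1 / 2]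
    for their deviations. To leading order the value is [e / (th e)]. *)
Lemma geom_const_upper e th : 0 < e -> 1000 * e <= 1 -> 1 / 2 <= th <= 1 ->
  (expR (e ^+ 2) - 1) / e * (1 - expR (- (th * e - e ^+ 2)))^-1 <=
  (1 + 4 * e) / th.
Proof.
move=> e0 e1 /andP[th0 th1].
have t0 : 0 < th * e - e ^+ 2.
  rewrite expr2 -mulrBl mulr_gt0//; lra.
have E : expR (e ^+ 2) - 1 <= 11 / 10 * e ^+ 2.
  by have := @expR_small (e ^+ 2) (sqr_ge0 _); nra.
have E' : expR (e ^+ 2) <= (1 - e ^+ 2)^-1 by apply: expR_le_inv; nra.
have {}E' : (expR (e ^+ 2) - 1) / e <= e / (1 - e ^+ 2).
  rewrite ler_pdivrMr//; apply: (@le_trans _ _ ((1 - e ^+ 2)^-1 - 1)).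
    by rewrite lerD2r.
  have : 1 - e ^+ 2 != 0 by rewrite gt_eqF// subr_gt0; nra.
  by move=> ?; rewrite le_eqVlt; apply/orP; left; apply/eqP; field.
have h0 : 0 <= (expR (e ^+ 2) - 1) / e.
  by rewrite divr_ge0 ?(ltW e0)// subr_ge0 -[leLHS]expR0 ler_expR sqr_ge0.
have i0 : 0 <= (1 - expR (- (th * e - e ^+ 2)))^-1.
  by rewrite invr_ge0 subr_ge0 expR_le1 oppr_le0 ltW.
apply: (le_trans (ler_pM h0 i0 E' (inv_expRN_le t0))).
have d0 : 0 < 1 - e ^+ 2 by nra.
have -> : e / (1 - e ^+ 2) * ((1 + (th * e - e ^+ 2)) / (th * e - e ^+ 2)) =
   (1 + (th * e - e ^+ 2)) / ((1 - e ^+ 2) * (th - e)).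
  by field; rewrite !gt_eqF//; lra.
rewrite ler_pdivrMr ?mulr_gt0//; last lra.
rewrite mulrAC ler_pdivlMr; last lra.
have h1 : th + th ^+ 2 * e + 7 / 10 * e <= (1 + 4 * e) * (th - e).
  have : 3 / 4 <= 4 * th - 1 - th ^+ 2 by nra.
  have : 4 * e ^+ 2 <= e / 250 by nra.
  nra.
have h2 : (1 + 4 * e) * (th - e) <= 2 by nra.
set W := (1 + 4 * e) * (th - e) in h1 h2.
have -> : (1 + 4 * e) * ((1 - e ^+ 2) * (th - e)) = W - e ^+ 2 * W by rewrite /W; ring.
have : e ^+ 2 * W <= e ^+ 2 * 2 by rewrite ler_wpM2l ?sqr_ge0.
have : 0 <= th * e ^+ 2 by rewrite mulr_ge0 ?sqr_ge0//; lra.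
have : e ^+ 2 <= e / 1000 by nra.
nra.
Qed.

(** Stopping after [n] layers loses the fraction [exp (- (e + e^2)) ^ n], at most [e] by the last
    hypothesis. *)
Lemma geom_const_lower e n : 0 < e -> 1000 * e <= 1 -> expR (- e) ^+ n <= e ->
  1 - 3 * e <= (1 - expR (- e ^+ 2)) / e * \sum_(s < n) expR (- (e + e ^+ 2)) ^+ s.
Proof.
move=> e0 e1 en.
have r0 : 0 < e + e ^+ 2 by nra.
rewrite geom_sum1 ?expR_lt1 ?oppr_lt0//.
have h1 : e * (1 - e ^+ 2) <= (1 - expR (- e ^+ 2)) / e.
  rewrite ler_pdivlMr//.
  have := @expRN_le (e ^+ 2) (sqr_ge0 _).
  have : (1 + e ^+ 2)^-1 <= 1 - e ^+ 2 + e ^+ 2 * e ^+ 2.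
    rewrite -div1r ler_pdivrMr; nra.
  rewrite !expr2; nra.
have h2 : expR (- (e + e ^+ 2)) ^+ n <= e.
  apply: le_trans en; rewrite lerXn2r ?nnegrE ?expR_ge0// ler_expR; nra.
have h3 : 1 - expR (- (e + e ^+ 2)) <= e + e ^+ 2.
  by have := expR_ge1Dx (- (e + e ^+ 2)); lra.
have h4 : 0 < 1 - expR (- (e + e ^+ 2)).
  by rewrite subr_gt0 expR_lt1 oppr_lt0.
rewrite mulrA ler_pdivlMr//.
apply: (@le_trans _ _ (e * (1 - e ^+ 2) * (1 - e))); last first.
  apply: ler_pM => //; [nra|nra|lra].
apply: (@le_trans _ _ ((1 - 3 * e) * (e + e ^+ 2))).
  by rewrite ler_wpM2l//; lra.
rewrite !expr2; nra.
Qed.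

Lemma excess_num e u : 0 < e -> 1000 * e <= 1 -> 0 <= u -> u <= 3 * e ->
  (1 + e) * ((expR (e * u) - 1) / e) <= (1 + 2 * e) * u.
Proof.
move=> e0 e1 u0 u3.
have eu : e * u <= 3 / 1000 * e by nra.
have eu0 : 0 <= e * u by rewrite mulr_ge0// ltW.
have d0 : 0 < 1 - e * u by lra.
have : expR (e * u) <= (1 - e * u)^-1 by apply: expR_le_inv; lra.
rewrite -div1r ler_pdivlMr// => hE.
have : (expR (e * u) - 1) / e * (1 - e * u) <= u.
  rewrite mulrAC ler_pdivrMr//; lra.
rewrite -ler_pdivlMr// => hE3; apply: (@le_trans _ _ ((1 + e) * (u / (1 - e * u)))).
  by rewrite ler_pM2l//; lra.
rewrite mulrA ler_pdivrMr// mulrAC ler_wpM2r//; nra.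
Qed.

(** The arithmetic of [zone1_incr_ge]: [T] and [T1] are the expected numbers of exceedances of the
    initial and of the final mean in the block, [u] is the increment of [H] at the mean and [z] the
    rescaled increment of the mean. *)
Lemma zone1_num e u z k0 k1 T T1 : 0 < e -> 1000 * e <= 1 -> 0 <= u -> 0 < k0 ->
  0 <= T -> 0 <= T1 -> T * (1 - 3 * e) <= T1 -> k1 - k0 <= (1 + 2 * e) * T ->
  k1 - k0 <= 3 * e * k0 -> (1 - 8 * e) * T1 <= z * k1 -> 0 <= k1 ->
  z <= (1 + 2 * e) * u -> (1 - 20 * e) * (k1 - k0) <= u * k0.
Proof.
move=> e0 e1 u0 k0_gt0 T0 T10 T1T hk1 r3 hz k1_ge0 zu.
have h1 : (1 + 2 * e) * (1 + 3 * e) <= 1 + 51 / 10 * e by clear -e0 e1; nra.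
have h2 : (1 - 20 * e) * (1 + 2 * e) <= 1 - 18 * e by clear -e0 e1; nra.
have h4 : (1 + 51 / 10 * e) * (1 - 18 * e) <= (1 - 8 * e) * (1 - 3 * e) by clear -e0 e1; nra.
have p8 : 0 < 1 - 8 * e by clear -e0 e1; lra.
have p20 : 0 < 1 - 20 * e by clear -e0 e1; lra.
have p2 : 0 < 1 + 2 * e by clear -e0; lra.
have p3 : 0 < 1 + 3 * e by clear -e0; lra.
have p18 : 0 <= 1 - 18 * e by clear -e0 e1; lra.
have k13 : k1 <= (1 + 3 * e) * k0 by clear -r3; lra.
have g1 : (1 - 8 * e) * ((1 - 3 * e) * T) <= (1 + 2 * e) * u * ((1 + 3 * e) * k0).
  apply: (@le_trans _ _ ((1 - 8 * e) * T1)).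
    by rewrite ler_pM2l// mulrC.
  apply: (le_trans hz); apply: (@le_trans _ _ ((1 + 2 * e) * u * k1)).
    by rewrite ler_wpM2r.
  by rewrite ler_wpM2l// mulr_ge0// ltW.
have g2 : (1 - 20 * e) * (k1 - k0) <= (1 - 20 * e) * ((1 + 2 * e) * T).
  by rewrite ler_pM2l.
apply: (le_trans g2).
have K : 0 < (1 + 2 * e) * (1 + 3 * e) by rewrite mulr_gt0.
rewrite -(ler_pM2l K).
apply: (@le_trans _ _ ((1 - 8 * e) * ((1 - 3 * e) * T))); last first.
  by apply: (le_trans g1); rewrite le_eqVlt; apply/orP; left; apply/eqP; ring.
rewrite !mulrA ler_wpM2r// -(mulrA _ (1 - 20 * e)).
apply: le_trans h4; apply: ler_pM => //; apply: mulr_ge0; exact: ltW.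
Qed.
End numeric.

(** * Exceedance counts and the increments of the mean over one block *)

Definition exceed {R : realType} (x y : nat -> R) (n a : nat) : nat :=
  \sum_(1 <= i < n.+1) (y a < x i)%R.

Section block.
Context {R : realType} (x y : nat -> R) (H c : R -> R) (eps m_ : R).
Hypothesis eps_gt0 : 0 < eps.
Hypothesis eps_small : 1000 * eps <= 1.
Hypothesis H_nondecr : forall u v, u <= v -> H u <= H v.
Hypothesis Hy : forall a, (0 < a)%N -> H (y a) = a%:R * eps.
Hypothesis Hc : forall m v, m_ <= m -> m <= v ->
  [/\ 0 < c m,
     (v - m) * c m <= (1 + eps) * ((expR (eps * (H v - H m)) - 1) / eps) &
     (1 - eps) * ((1 - expR (- (eps * (H v - H m)))) / eps) <= (v - m) * c m].

Let eps20 : 0 < 1 - 20 * eps.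
Proof. by have e1 := eps_small; have e0 := eps_gt0; lra. Qed.

(** A flat piece of [H] above [m_] would make the upper bound in [Hc] nonpositive. *)
Lemma H_incr m v : m_ <= m -> m < v -> H m < H v.
Proof.
move=> mm mv; have e0 := eps_gt0; have [c0 h _] := Hc mm (ltW mv).
rewrite ltNge; apply/negP => Hvm.
have : 0 < (v - m) * c m by rewrite mulr_gt0 ?subr_gt0.
rewrite ltNge => /negP; apply; apply: (le_trans h).
rewrite pmulr_rle0; last by lra.
rewrite pmulr_lle0 ?invr_gt0// subr_le0 -[leRHS]expR0 ler_expR.
by rewrite pmulr_rle0// subr_le0.
Qed.

Lemma y_incr a a' : (0 < a)%N -> (a < a')%N -> y a < y a'.
Proof.
move=> a0 aa'; rewrite ltNge; apply/negP => /H_nondecr.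
rewrite !Hy ?(leq_trans _ aa')// ler_pM2r// ler_nat; lia.
Qed.

Lemma y_nondecr a a' : (0 < a)%N -> (a <= a')%N -> y a <= y a'.
Proof.
by move=> a0; rewrite leq_eqVlt => /predU1P[->//|/(y_incr a0)/ltW].
Qed.

Lemma grid l : eps <= l -> exists a, [/\ (0 < a)%N, a%:R * eps <= l &
  l < a.+1%:R * eps].
Proof.
move=> el; have e0 := eps_gt0.
have l0 : 0 <= l / eps by rewrite divr_ge0//; lra.
exists (Num.truncn (l / eps)); have /andP[h1 h2] := truncn_itv l0.
split; last 2 first.
- by rewrite -ler_pdivlMr.
- by rewrite -ltr_pdivrMr.
- by rewrite -ltnS -(ltr_nat R) (le_lt_trans _ h2)// ler_pdivlMr// mul1r.
Qed.

(** If [y (a + s)] is the last level below [v], the weighted sum telescopes to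
    [(exp (eps^2 (s + 1)) - 1) / eps], the value at the first level not below [v]. *)
Lemma layer_upper a v n : (0 < a)%N -> v <= y (a + n) ->
  (expR (eps * (H v - a%:R * eps)) - 1) / eps <=
  \sum_(s < n) (expR (eps ^+ 2) - 1) / eps * expR (eps ^+ 2) ^+ s *
     (y (a + s)%N < v)%R%:R.
Proof.
move=> a0; have q1 : 1 < expR (eps ^+ 2) by rewrite expR_gt1 exprn_gt0.
elim: n => [|n IH] vy.
  rewrite big_ord0; rewrite pmulr_lle0 ?invr_gt0// subr_le0 -[leRHS]expR0 ler_expR.
  by rewrite pmulr_rle0// subr_le0 -Hy// H_nondecr// -[a]addn0.
have [vgt|vle] := ltP (y (a + n)) v; last first.
  by rewrite big_ord_recr/= ltNge vle/= mulr0 addr0 IH.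
rewrite (eq_bigr (fun s : 'I_n.+1 => (expR (eps ^+ 2) - 1) / eps * expR (eps ^+ 2) ^+ s)); last first.
  move=> s _; rewrite (le_lt_trans _ vgt) ?mulr1//.
  by apply: y_nondecr; [rewrite addn_gt0 a0|rewrite leq_add2l -ltnS].
rewrite -mulr_sumr mulrAC -subrX1 ler_pM2r ?invr_gt0// lerD2r -expRM_natl ler_expR.
rewrite mulrC expr2 mulrA ler_pM2r// lerBlDl -mulrDl -natrD -Hy ?addnS//.
by apply: H_nondecr; rewrite -addnS.
Qed.

(** The same telescoping with decreasing weights; the index is shifted by one so that only layers
    lying entirely below [v] count. *)
Lemma layer_lower a v n : (0 < a)%N -> a%:R * eps <= H v ->
  \sum_(s < n) (1 - expR (- eps ^+ 2)) / eps * expR (- eps ^+ 2) ^+ s *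
     (y (a + s).+1 < v)%R%:R <=
  (1 - expR (- (eps * (H v - a%:R * eps)))) / eps.
Proof.
move=> a0 av; have q1 : expR (- eps ^+ 2) < 1 by rewrite expR_lt1 oppr_lt0 exprn_gt0.
elim: n => [|n IH].
  rewrite big_ord0; rewrite divr_ge0 ?(ltW eps_gt0)// subr_ge0 expR_le1 oppr_le0.
  by rewrite mulr_ge0 ?(ltW eps_gt0)// subr_ge0.
rewrite big_ord_recr/=; have [vgt|vle] := ltP; last by rewrite mulr0 addr0.
apply: (@le_trans _ _ (\sum_(s < n.+1) (1 - expR (- eps ^+ 2)) / eps * expR (- eps ^+ 2) ^+ s)).
  rewrite big_ord_recr/= mulr1 lerD2r; apply: ler_sum => s _.
  by rewrite ler_piMr ?lern1 ?leq_b1// mulr_ge0 ?exprn_ge0 ?expR_ge0// divr_ge0 ?(ltW eps_gt0)// subr_ge0 ltW.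
rewrite -mulr_sumr mulrAC -[1 - expR _]opprB mulNr -subrX1 opprB ler_pM2r ?invr_gt0//.
rewrite lerD2l lerN2 -expRM_natl ler_expR mulrN lerN2.
rewrite mulrC expr2 -mulrA ler_pM2l// lerBrDl [_ * n.+1%:R]mulrC -mulrDl -natrD -Hy ?addnS//.
by apply: H_nondecr; rewrite ltW.
Qed.

(** The block runs from [n] to [n']. Counts are controlled up to level [A], no observation up to
    [n'] exceeds level [B], and deviations scale like the square root of the tail
    [exp (- a eps)]. *)
Context (n n' A B : nat) (D : R).
Hypothesis n_gt0 : (0 < n)%N.
Hypothesis nn' : (n <= n')%N.
Hypothesis D_ge0 : 0 <= D.
Local Notation b := (n'%:R - n%:R : R).
Hypothesis hB : forall a, (0 < a <= A)%N ->
  `|(exceed x y n' a)%:R - (exceed x y n a)%:R - b * expR (- (a%:R * eps))| <=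
  D * expR (- (a%:R * eps) / 2).
Hypothesis hC : forall a, (0 < a <= A)%N ->
  `|(exceed x y n a)%:R - n%:R * expR (- (a%:R * eps))| <=
  D * expR (- (a%:R * eps) / 2).
Local Notation m0 := (kept_mean x n).
Local Notation m1 := (kept_mean x n').
Local Notation k0 := ((kept x n)%:R : R).
Local Notation k1 := ((kept x n')%:R : R).
Local Notation l0 := (H m0).
Local Notation l1 := (H m1).
Hypothesis hm : m_ <= m0.
Hypothesis hl0 : eps <= l0.
Hypothesis B_gt0 : (0 < B)%N.
Hypothesis xB : forall i, (0 < i <= n')%N -> x i <= y B.

Lemma exceedD a : (exceed x y n' a)%:R - (exceed x y n a)%:R =
  \sum_(n.+1 <= i < n'.+1) (y a < x i)%R%:R :> R.
Proof.
rewrite /exceed (@big_cat_nat _ _ _ n.+1 1 n'.+1)//= ?ltnS ?leq0n//.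
by rewrite natrD addrAC subrr add0r natr_sum.
Qed.

Let n'_gt0 : (0 < n')%N := leq_trans n_gt0 nn'.
Let m01 : m0 <= m1 := kept_mean_nondecr x n_gt0 nn'.
Let l01 : l0 <= l1 := H_nondecr m01.
Let b_ge0 : 0 <= b.
Proof. by rewrite subr_ge0 ler_nat. Qed.

Lemma mean_le_top : l1 <= B%:R * eps.
Proof. by rewrite -Hy// H_nondecr// kept_mean_le. Qed.

Lemma grid_le_top a : a%:R * eps <= l1 -> (a <= B)%N.
Proof.
move=> /le_trans/(_ mean_le_top); by rewrite ler_pM2r// ler_nat.
Qed.

Lemma gt_mean_exceed a v : (0 < a)%N -> a%:R * eps <= l0 -> m0 < v -> y a < v.
Proof.
move=> a0 al mv; rewrite ltNge; apply/negP => /H_nondecr.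
by rewrite Hy// => /le_trans/(_ al); rewrite leNgt (H_incr hm mv).
Qed.

Lemma mean_lt_grid a m : (0 < a)%N -> H m < a%:R * eps -> m <= y a.
Proof.
move=> a0; rewrite -Hy// => h; rewrite leNgt; apply/negP => /ltW/H_nondecr.
by rewrite leNgt h.
Qed.

Lemma expR_grid_le a l : a%:R * eps <= l -> l < a.+1%:R * eps ->
  expR (- (a%:R * eps)) <= expR (- l + eps).
Proof. by move=> _; rewrite -natr1 ler_expR mulrDl mul1r => h; lra. Qed.

Lemma kept_incr_le : (B <= A)%N ->
  k1 - k0 <= b * expR (- l0 + eps) + D * expR ((- l0 + eps) / 2).
Proof.
move=> BA; have [a [a0 al la]] := grid hl0.
have aA : (0 < a <= A)%N by rewrite a0 (leq_trans (grid_le_top (le_trans al l01))).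
have := kept_block_le x n_gt0 nn'; rewrite -(ler_nat R) natrD natr_sum -lerBlDl.
move=> /le_trans; apply.
apply: (@le_trans _ _ ((exceed x y n' a)%:R - (exceed x y n a)%:R)).
  rewrite exceedD; apply: ler_sum => i _; rewrite ler_nat.
  by case: ltP => // h; rewrite (gt_mean_exceed a0 al h).
have := hB aA; rewrite ler_distl => /andP[_ /le_trans]; apply.
rewrite lerD// ?ler_wpM2l// ?(expR_grid_le al la)// ler_expR.
by rewrite ler_pM2r//; move: la; rewrite -natr1 mulrDl mul1r; lra.
Qed.

Lemma kept_incr_ge : (B < A)%N ->
  b * expR (- l1 - eps) - D * expR (- l1 / 2) <= k1 - k0.
Proof.
move=> BA; have [a [a0 al la]] := grid (le_trans hl0 l01).
have aA : (0 < a.+1 <= A)%N by rewrite (leq_ltn_trans (grid_le_top al)).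
have := kept_block_ge n_gt0 nn' (mean_lt_grid (ltn0Sn a) la).
rewrite -(ler_nat R) natrD natr_sum -lerBrDl; apply: le_trans.
rewrite -exceedD; have := hB aA; rewrite ler_distl => /andP[+ _]; apply: le_trans.
rewrite lerB ?ler_wpM2l// ler_expR; last by rewrite ler_pM2r// lerN2 ltW.
by rewrite -natr1 mulrDl mul1r; lra.
Qed.

Lemma kept_start_ge : (B < A)%N ->
  n%:R * expR (- l0 - eps) - D * expR (- l0 / 2) <= k0.
Proof.
move=> BA; have [a [a0 al la]] := grid hl0.
have aA : (0 < a.+1 <= A)%N by rewrite (leq_ltn_trans (grid_le_top (le_trans al l01))).
have := kept_ge n_gt0 (mean_lt_grid (ltn0Sn a) la).
rewrite -(ler_nat R); apply: le_trans.
have := hC aA; rewrite ler_distl => /andP[+ _]; apply: le_trans.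
rewrite lerB ?ler_wpM2l// ler_expR; last by rewrite ler_pM2r// lerN2 ltW.
by rewrite -natr1 mulrDl mul1r; lra.
Qed.

Let c0 : 0 < c m0.
Proof. by have [] := Hc hm m01. Qed.

(** The excesses over [m0] are majorized through [Hc], cut into layers, and each layer is counted by
    [hB]. Layers above [B] are empty. *)
Lemma excess_incr_le : (B <= A)%N ->
  c m0 * (k1 * (m1 - m0)) <=
  (1 + 7 * eps) * (b * expR (- l0)) + 4 * (D * expR (- l0 / 2)).
Proof.
move=> BA; have e0 := eps_gt0; have e1 := eps_small.
have [a [a0 al la]] := grid hl0.
have aB := grid_le_top (le_trans al l01).
pose ka := (expR (eps ^+ 2) - 1) / eps.
have ka0 : 0 <= ka.
  by rewrite divr_ge0 ?(ltW eps_gt0)// subr_ge0 -[leLHS]expR0 ler_expR sqr_ge0.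
pose q := expR (eps ^+ 2).
pose phi v : R := (1 + eps) / c m0 *
   \sum_(s < B - a) ka * q ^+ s * (y (a + s)%N < v)%R%:R.
have := @excess_block_le _ x n n' phi n_gt0 nn'.
rewrite -(ler_pM2l c0) => h; apply: (le_trans (h _ _)) => {h}.
- move=> v; apply: mulr_ge0; first by rewrite divr_ge0 ?(ltW c0)//; lra.
  by apply: sumr_ge0 => s _; rewrite mulr_ge0// mulr_ge0// exprn_ge0 ?expR_ge0.
- move=> i /andP[ni ni'] mxi.
  have [_ + _] := Hc hm (ltW mxi); rewrite -ler_pdivlMr// => /le_trans; apply.
  rewrite /phi [leRHS]mulrAC ler_pM2r ?invr_gt0// ler_pM2l; last lra.
  have yB : x i <= y (a + (B - a))%N.
    by rewrite subnKC// xB// ni' (leq_ltn_trans _ ni).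
  apply: le_trans (layer_upper a0 yB).
  rewrite ler_pM2r ?invr_gt0// lerD2r ler_expR ler_pM2l//; lra.
have cK (S : R) : c m0 * ((1 + eps) / c m0 * S) = (1 + eps) * S.
  by field; rewrite gt_eqF.
rewrite /phi -mulr_sumr cK exchange_big/=.
have bnd s : (s < B - a)%N -> \sum_(n.+1 <= i < n'.+1) ka * q ^+ s * (y (a + s)%N < x i)%R%:R <=
   ka * (b * expR (- l0 + eps) * expR (- (eps - eps ^+ 2)) ^+ s +
   D * expR ((- l0 + eps) / 2) * expR (- (eps / 2 - eps ^+ 2)) ^+ s).
  move=> sB; rewrite -mulr_sumr -exceedD -mulrA ler_wpM2l//.
  have aA : (0 < a + s <= A)%N by clear -a0 aB sB BA; lia.
  have q0 : 0 <= q ^+ s by rewrite exprn_ge0 ?expR_ge0.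
  have := hB aA; rewrite ler_distl => /andP[_ h].
  apply: (le_trans (ler_wpM2l q0 h)) => {h}.
  rewrite mulrDr -!(mulrCA b) -!(mulrCA D) -!mulrA.
  rewrite lerD// ler_wpM2l// /q -!expRM_natl -!expRD ler_expR;
    move: la; rewrite -natr1 natrD !mulrDl mul1r; lra.
apply: (@le_trans _ _ ((1 + eps) * \sum_(s < B - a) ka * (b * expR (- l0 + eps) * expR (- (eps - eps ^+ 2)) ^+ s +
   D * expR ((- l0 + eps) / 2) * expR (- (eps / 2 - eps ^+ 2)) ^+ s))).
  rewrite ler_pM2l; last lra.
  by apply: ler_sum => s _; exact: bnd.
rewrite -mulr_sumr big_split/= -!mulr_sumr.
have half : (1 / 2 : R) <= (1 / 2 : R) <= 1 by apply/andP; split; lra.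
have one : (1 / 2 : R) <= (1 : R) <= 1 by apply/andP; split; lra.
have := geom_const_upper e0 e1 one; rewrite divr1 mul1r -/ka => g1.
have := geom_const_upper e0 e1 half; rewrite -/ka.
rewrite (_ : 1 / 2 * eps = eps / 2); last by lra.
move=> g2; set r1 := expR (- (eps - _)) in g1 *.
set r2 := expR (- (eps / 2 - _)) in g2 *.
have {}g1 : ka * \sum_(s < B - a) r1 ^+ s <= 1 + 4 * eps.
  apply: le_trans g1; rewrite ler_wpM2l// geom_sum_le// expR_ge0/= expR_lt1; nra.
have {}g2 : ka * \sum_(s < B - a) r2 ^+ s <= 2 + 8 * eps.
  apply: le_trans (le_trans g2 _); last by lra.
  rewrite ler_wpM2l// geom_sum_le// expR_ge0/= expR_lt1; nra.
have x1 : expR (- l0 + eps) <= expR (- l0) * (1 + 11 / 10 * eps).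
  by rewrite expRD ler_pM2l ?expR_gt0// expR_small//; lra.
have x2 : expR ((- l0 + eps) / 2) <= expR (- l0 / 2) * (1 + 11 / 10 * eps).
  rewrite mulrDl expRD ler_pM2l ?expR_gt0//.
  by apply: (le_trans (expR_small _ _)); lra.
have kaD u v S1 S2 : ka * (u * S1 + v * S2) = u * (ka * S1) + v * (ka * S2) by ring.
rewrite kaD.
have s1 : 0 <= \sum_(s < B - a) r1 ^+ s by apply: sumr_ge0 => s _; rewrite exprn_ge0 ?expR_ge0.
have s2 : 0 <= \sum_(s < B - a) r2 ^+ s by apply: sumr_ge0 => s _; rewrite exprn_ge0 ?expR_ge0.
apply: (@le_trans _ _ ((1 + eps) * (b * (expR (- l0) * (1 + 11 / 10 * eps)) * (1 + 4 * eps) +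
   D * (expR (- l0 / 2) * (1 + 11 / 10 * eps)) * (2 + 8 * eps)))).
  rewrite ler_wpM2l//; first lra.
  by apply: lerD; apply: ler_pM => //; (try exact: mulr_ge0);
    (try by rewrite mulr_ge0 ?expR_ge0); rewrite ler_wpM2l.
have f1 : (1 + eps) * ((1 + 11 / 10 * eps) * (1 + 4 * eps)) <= 1 + 7 * eps by nra.
have f2 : (1 + eps) * ((1 + 11 / 10 * eps) * (2 + 8 * eps)) <= 4 by nra.
set T1 := b * expR (- l0); set T2 := D * expR (- l0 / 2).
have T1_ge0 : 0 <= T1 by rewrite mulr_ge0 ?expR_ge0.
have T2_ge0 : 0 <= T2 by rewrite mulr_ge0 ?expR_ge0.
apply: (@le_trans _ _ ((1 + eps) * ((1 + 11 / 10 * eps) * (1 + 4 * eps)) * T1 +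
   (1 + eps) * ((1 + 11 / 10 * eps) * (2 + 8 * eps)) * T2)).
  rewrite le_eqVlt; apply/orP; left; apply/eqP; by rewrite /T1 /T2; ring.
by rewrite lerD// ler_wpM2r.
Qed.

(** Only items above the final mean are sure to be kept, so the layers start at the grid level just
    above it and the bound involves [l1]. *)
Lemma excess_incr_ge n1 : (B + n1 + 1 <= A)%N -> expR (- eps) ^+ n1 <= eps ->
  (1 - 7 * eps) * (b * expR (- l1)) - 4 * (D * expR (- l1 / 2)) <=
  c m0 * (k1 * (m1 - m0)).
Proof.
move=> BA en; have e0 := eps_gt0; have e1 := eps_small.
have [a [a0 al la]] := grid (le_trans hl0 l01).
have aB := grid_le_top al.
pose ka := (1 - expR (- eps ^+ 2)) / eps.
have ka0 : 0 <= ka.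
  by rewrite divr_ge0 ?(ltW eps_gt0)// subr_ge0 expR_le1 oppr_le0 sqr_ge0.
pose q := expR (- eps ^+ 2).
have q0 s : 0 <= q ^+ s by rewrite exprn_ge0 ?expR_ge0.
have kq0 s : 0 <= ka * q ^+ s by rewrite mulr_ge0.
pose phi v : R := (1 - eps) / c m0 *
   \sum_(s < n1) ka * q ^+ s * (y (a.+1 + s).+1 < v)%R%:R.
have cK (S : R) : c m0 * ((1 - eps) / c m0 * S) = (1 - eps) * S.
  by field; rewrite gt_eqF.
have := @excess_block_ge _ x n n' (y a.+1) phi n_gt0 nn' (mean_lt_grid (ltn0Sn a) la).
rewrite -(ler_pM2l c0) => h; apply: (le_trans _ (h _ _)) => {h}; last 2 first.
- move=> v vy; rewrite /phi big1 ?mulr0// => s _.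
  rewrite ltNge (le_trans vy) ?mulr0//.
  by apply: y_nondecr => //; rewrite addSn ltnS -addnS leq_addr.
- move=> v yv.
  have mv : m0 <= v.
    by apply: le_trans (ltW yv); apply: (le_trans m01); apply: mean_lt_grid.
  have av : a.+1%:R * eps <= H v by rewrite -Hy// H_nondecr// ltW.
  rewrite -(ler_pM2l c0) cK [leRHS]mulrC.
  have [_ _] := Hc hm mv; apply: le_trans.
  rewrite ler_pM2l; last lra.
  apply: (le_trans (layer_lower n1 (ltn0Sn a) av)).
  rewrite ler_pM2r ?invr_gt0// lerD2l lerN2 ler_expR lerN2 ler_pM2l//.
  rewrite lerD2l lerN2; move: (l01) la; lra.
rewrite -mulr_sumr cK exchange_big/=.
(* As [a eps <= l1], the level of index [(a.+1 + s).+1] is at most [l1 + s eps + 2 eps], whence the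
   loss [2 * eps]. *)
have bnd s : (s < n1)%N ->
   ka * (b * expR (- l1 - 2 * eps) * expR (- (eps + eps ^+ 2)) ^+ s -
   D * expR (- l1 / 2) * expR (- (eps / 2)) ^+ s) <=
   \sum_(n.+1 <= i < n'.+1) ka * q ^+ s * (y (a.+1 + s).+1 < x i)%R%:R.
  move=> sB; rewrite -mulr_sumr -exceedD -[leRHS]mulrA ler_wpM2l//.
  have aA : (0 < (a.+1 + s).+1 <= A)%N by clear -aB sB BA; lia.
  have := hB aA; rewrite ler_distl => /andP[h _].
  apply: (le_trans _ (ler_wpM2l (q0 s) h)) => {h}.
  rewrite mulrDr mulrN -!(mulrCA b) -!(mulrCA D) -!mulrA.
  have asE : (a.+1 + s).+1%:R = a%:R + s%:R + 2 :> R.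
    by rewrite -natr1 natrD -natr1; lra.
  have se0 : 0 <= s%:R * eps ^+ 2 by rewrite mulr_ge0 ?sqr_ge0.
  rewrite lerB// ler_wpM2l// /q -!expRM_natl -!expRD ler_expR;
    rewrite asE; move: al se0; rewrite ?mulrDl; lra.
apply: (@le_trans _ _ ((1 - eps) * \sum_(s < n1) ka * (b * expR (- l1 - 2 * eps) * expR (- (eps + eps ^+ 2)) ^+ s -
   D * expR (- l1 / 2) * expR (- (eps / 2)) ^+ s))); last first.
  rewrite ler_pM2l; last lra.
  by apply: ler_sum => s _; exact: bnd.
rewrite -mulr_sumr sumrB/= -!mulr_sumr.
have g1 := geom_const_lower e0 e1 en.
have kaD u v S1 S2 : ka * (u * S1 - v * S2) = u * (ka * S1) - v * (ka * S2) by ring.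
rewrite kaD -/ka in g1 *.
have g2 : ka * \sum_(s < n1) expR (- (eps / 2)) ^+ s <= 3.
  have kae : ka <= eps.
    by rewrite /ka ler_pdivrMr//; have := expR_ge1Dx (- eps ^+ 2); rewrite expr2; lra.
  have e2 : 0 < eps / 2 by lra.
  have h : \sum_(s < n1) expR (- (eps / 2)) ^+ s <= (1 + eps / 2) / (eps / 2).
    apply: le_trans (inv_expRN_le e2); apply: geom_sum_le.
    by rewrite expR_ge0 expR_lt1 oppr_lt0.
  apply: (@le_trans _ _ (eps * ((1 + eps / 2) / (eps / 2)))).
    apply: ler_pM => //; apply: sumr_ge0 => s _; by rewrite exprn_ge0 ?expR_ge0.
  rewrite mulrA ler_pdivrMr//; nra.
have x1 : expR (- l1) * (1 - 2 * eps) <= expR (- l1 - 2 * eps).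
  by rewrite expRD ler_pM2l ?expR_gt0// expR_ge1Dx.
set T1 := b * expR (- l1); set T2 := D * expR (- l1 / 2).
have T1_ge0 : 0 <= T1 by rewrite mulr_ge0 ?expR_ge0.
have T2_ge0 : 0 <= T2 by rewrite mulr_ge0 ?expR_ge0.
set S1 := ka * _ in g1 *; set S2 := ka * _ in g2 *.
have y1 : T1 * ((1 - 2 * eps) * (1 - 3 * eps)) <= b * expR (- l1 - 2 * eps) * S1.
  rewrite mulrA ler_pM//; [|lra|].
    rewrite mulr_ge0//; lra.
  by rewrite /T1 -mulrA ler_wpM2l.
have y2 : T2 * S2 <= T2 * 3 by rewrite ler_wpM2l.
have f1 : 1 - 7 * eps <= (1 - eps) * ((1 - 2 * eps) * (1 - 3 * eps)) by nra.
apply: (@le_trans _ _ ((1 - eps) * (T1 * ((1 - 2 * eps) * (1 - 3 * eps)) - T2 * 3))); last first.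
  rewrite ler_wpM2l//; lra.
have := ler_wpM2r T1_ge0 f1.
have : 0 <= eps * T2 by rewrite mulr_ge0// ltW.
nra.
Qed.

Let k0_gt0 : 0 < k0.
Proof. by rewrite ltr0n kept_gt0. Qed.

Let k01 : k0 <= k1.
Proof. by rewrite ler_nat kept_nondecr. Qed.

Let k1_gt0 : 0 < k1 := lt_le_trans k0_gt0 k01.

(** Solves the lower bound in [Hc] for the increment of [H]; [1 - exp (- w) >= w / (1 + w)] makes it
    linear in [l1 - l0]. *)
Lemma incr_le_scaled_excess : (l1 - l0) * (1 - eps - eps * (c m0 * (m1 - m0))) <=
  c m0 * (m1 - m0).
Proof.
have e0 := eps_gt0; have e1 := eps_small.
have [_ _] := Hc hm m01; rewrite [leRHS]mulrC; set z := c m0 * _; set u := l1 - l0.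
have u0 : 0 <= u by rewrite subr_ge0.
have w0 : 0 <= eps * u by rewrite mulr_ge0// ltW.
have w1 : 0 < 1 + eps * u by rewrite ltr_pwDl.
have := expRN_le w0; set E := expR _ => hE.
have hE1 : E * (1 + eps * u) <= 1 by rewrite -ler_pdivlMr// div1r.
rewrite mulrA ler_pdivrMr// => h.
have h2 : eps * u <= (1 - E) * (1 + eps * u) by lra.
have e3 : 0 < 1 - eps by lra.
have h3 : (1 - eps) * (eps * u) <= z * eps * (1 + eps * u).
  apply: (@le_trans _ _ ((1 - eps) * ((1 - E) * (1 + eps * u)))).
    by rewrite ler_pM2l.
  by rewrite mulrA ler_pM2r.
rewrite -(ler_pM2l e0); nra.
Qed.

(** In zone 1 the deviation is at most [eps^2] times the expected count of the block. Then
    [c m0 k1 (m1 - m0)] is at most, and [k1 - k0] at least, [b exp (- l0)] up to factors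
    [1 + O(eps)]; their quotient gives the last bound. *)
Lemma zone1_incr_le : (B < A)%N -> eps * n%:R <= b -> b <= 2 * eps * n%:R ->
  D <= eps ^+ 2 * (b * expR (- l0 / 2)) ->
  [/\ (1 - 2 * eps) * (n%:R * expR (- l0)) <= k0,
      D * expR (- l0 / 2) <= eps ^+ 2 * (b * expR (- l0)) &
      l1 - l0 <= (1 + 20 * eps) * ((k1 - k0) / k1)].
Proof.
move=> BA bn bn2 Dz; have e0 := eps_gt0; have e1 := eps_small.
have E0 := expR_gt0 (- l0).
have D1 : D * expR (- l0 / 2) <= eps ^+ 2 * (b * expR (- l0)).
  have -> : expR (- l0) = expR (- l0 / 2) * expR (- l0 / 2).
    by rewrite -expRD -splitr.
  by have := ler_wpM2r (expR_ge0 (- l0 / 2)) Dz; rewrite -!mulrA.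
have hz := excess_incr_le (ltnW BA).
have hk0 := kept_start_ge BA.
have hk := kept_incr_ge BA.
have nR : 0 < n%:R :> R by rewrite ltr0n.
set E := expR (- l0) in E0 D1 hz *.
set T := b * E in D1 hz.
have nE0 : 0 < n%:R * E by rewrite mulr_gt0.
have T0 : 0 <= T by rewrite mulr_ge0// ltW.
have T2 : T <= 2 * eps * (n%:R * E) by rewrite /T mulrA ler_pM2r.
have e2 : eps ^+ 2 <= eps / 1000 by rewrite expr2; nra.
have e2T : eps ^+ 2 * T <= eps / 1000 * T by rewrite ler_wpM2r.
have k0n : (1 - 2 * eps) * (n%:R * E) <= k0.
  apply: le_trans hk0.
  have : n%:R * (E * (1 - eps)) <= n%:R * expR (- l0 - eps).
    by rewrite ler_pM2l// expRD ler_pM2l// expR_ge1Dx.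
  nra.
have {}hz : c m0 * (m1 - m0) * k1 <= (1 + 8 * eps) * T.
  by rewrite -mulrA [_ * k1]mulrC; apply: (le_trans hz); nra.
have hu := incr_le_scaled_excess.
set z := c m0 * (m1 - m0) in hz hu.
(* The block brings a rescaled excess of about [2 eps n exp (- l0)] at most, and [k0] is at least
   about [n exp (- l0)]. So [z = O(eps)], and [incr_le_scaled_excess] is nearly [l1 - l0 <= z]. *)
have z3 : z <= 3 * eps.
  rewrite -(ler_pM2r k1_gt0); apply: (le_trans hz).
  apply: (@le_trans _ _ (3 * eps * k0)); last by rewrite ler_pM2l//; lra.
  apply: (@le_trans _ _ (3 * eps * ((1 - 2 * eps) * (n%:R * E)))); last first.
    by rewrite ler_pM2l//; lra.
  apply: (@le_trans _ _ ((1 + 8 * eps) * (2 * eps * (n%:R * E)))).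
    by rewrite ler_pM2l//; lra.
  have : 0 <= eps * (n%:R * E) by rewrite mulr_ge0// ltW.
  set Q := eps * _ => Q0.
  have -> : (1 + 8 * eps) * (2 * eps * (n%:R * E)) = (1 + 8 * eps) * 2 * Q by rewrite /Q; ring.
  have -> : 3 * eps * ((1 - 2 * eps) * (n%:R * E)) = 3 * (1 - 2 * eps) * Q by rewrite /Q; ring.
  by rewrite ler_wpM2r//; lra.
have u0 : 0 <= l1 - l0 by rewrite subr_ge0.
have u1 : l1 - l0 <= (1 + 2 * eps) * z.
  have z0 : 0 <= z by rewrite mulr_ge0 ?(ltW c0)// subr_ge0.
  have : (l1 - l0) * (1 - eps - 3 * eps ^+ 2) <= z.
    apply: le_trans hu; rewrite ler_wpM2l//; nra.
  have : 0 < 1 - eps - 3 * eps ^+ 2 by lra.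
  move=> d0; rewrite -ler_pdivlMr// => /le_trans; apply.
  rewrite ler_pdivrMr// mulrAC ler_peMl//; nra.
have u4 : l1 - l0 <= 4 * eps by nra.
have hk1 : (1 - 6 * eps) * T <= k1 - k0.
  apply: le_trans hk.
  have : b * (E * (1 - 5 * eps)) <= b * expR (- l1 - eps).
    rewrite ler_wpM2l//.
    have -> : - l1 - eps = - l0 + - (l1 - l0 + eps) by ring.
    rewrite expRD ler_pM2l//.
    by have := expR_ge1Dx (- (l1 - l0 + eps)); lra.
  have : D * expR (- l1 / 2) <= D * expR (- l0 / 2).
    by rewrite ler_wpM2l// ler_expR ler_pM2r// lerN2.
  rewrite mulrA -/T; nra.
split => //.
rewrite mulrA ler_pdivlMr//.
apply: (@le_trans _ _ ((1 + 2 * eps) * ((1 + 8 * eps) * T))).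
  apply: (@le_trans _ _ ((1 + 2 * eps) * z * k1)); first by rewrite ler_pM2r.
  by rewrite -mulrA ler_pM2l//; lra.
apply: (@le_trans _ _ ((1 + 20 * eps) * ((1 - 6 * eps) * T))); last first.
  by rewrite ler_pM2l//; lra.
by rewrite !mulrA ler_wpM2r//; nra.
Qed.

(** The zone 1 condition is imposed at [l1], where [excess_incr_ge] counts; it then holds at [l0]
    too. If the level jumps by [3 eps] the claim is immediate, since [ln k] grows by at most
    [3 eps]; otherwise [exp (- l1)] is close to [exp (- l0)]. *)
Lemma zone1_incr_ge n1 : (B + n1 + 1 <= A)%N -> expR (- eps) ^+ n1 <= eps ->
  eps * n%:R <= b -> b <= 2 * eps * n%:R ->
  D <= eps ^+ 2 * (b * expR (- l1 / 2)) ->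
  (1 - 20 * eps) * (ln k1 - ln k0) <= l1 - l0.
Proof.
move=> BA en bn bn2 Dz1; have e0 := eps_gt0; have e1 := eps_small.
have BA' : (B < A)%N by clear -BA; lia.
have Dz : D <= eps ^+ 2 * (b * expR (- l0 / 2)).
  apply: (le_trans Dz1); rewrite ler_wpM2l ?sqr_ge0// ler_wpM2l// ler_expR.
  by rewrite ler_pM2r// lerN2.
have [k0n D1 _] := zone1_incr_le BA' bn bn2 Dz.
have hk := kept_incr_le (ltnW BA').
have hz := excess_incr_ge BA en.
have D2 : D * expR (- l1 / 2) <= eps ^+ 2 * (b * expR (- l1)).
  have -> : expR (- l1) = expR (- l1 / 2) * expR (- l1 / 2).
    by rewrite -expRD -splitr.
  by have := ler_wpM2r (expR_ge0 (- l1 / 2)) Dz1; rewrite -!mulrA.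
have E0 := expR_gt0 (- l0).
have nR : 0 < n%:R :> R by rewrite ltr0n.
set E := expR (- l0) in E0 D1 hz k0n *.
set T := b * E in D1.
have T0 : 0 <= T by rewrite mulr_ge0// ltW.
have T2 : T <= 2 * eps * (n%:R * E) by rewrite /T mulrA ler_pM2r.
have e2 : eps ^+ 2 <= eps / 1000 by rewrite expr2; nra.
have e2T : eps ^+ 2 * T <= eps / 1000 * T by rewrite ler_wpM2r.
have x0 : expR (eps / 2) <= 2 by apply: (le_trans (expR_small _ _)); lra.
have hk1 : k1 - k0 <= (1 + 2 * eps) * T.
  apply: (le_trans hk).
  have x1 : b * expR (- l0 + eps) <= T * (1 + 11 / 10 * eps).
    by rewrite /T -mulrA ler_wpM2l// expRD ler_pM2l// expR_small//; lra.
  have x2 : D * expR ((- l0 + eps) / 2) <= D * expR (- l0 / 2) * 2.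
    by rewrite -mulrA ler_wpM2l// mulrDl expRD ler_pM2l ?expR_gt0.
  nra.
have r3 : k1 - k0 <= 3 * eps * k0.
  apply: (le_trans hk1).
  apply: (@le_trans _ _ (3 * eps * ((1 - 2 * eps) * (n%:R * E)))); last first.
    by rewrite ler_pM2l//; lra.
  apply: (@le_trans _ _ ((1 + 2 * eps) * (2 * eps * (n%:R * E)))).
    by rewrite ler_pM2l//; lra.
  have : 0 <= eps * (n%:R * E) by rewrite !mulr_ge0// ltW.
  set Q := eps * _ => Q0.
  have -> : (1 + 2 * eps) * (2 * eps * (n%:R * E)) = (1 + 2 * eps) * 2 * Q by rewrite /Q; ring.
  have -> : 3 * eps * ((1 - 2 * eps) * (n%:R * E)) = 3 * (1 - 2 * eps) * Q by rewrite /Q; ring.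
  by rewrite ler_wpM2r//; lra.
have lnk : ln k1 - ln k0 <= (k1 - k0) / k0.
  rewrite -ln_div ?posrE//.
  have -> : k1 / k0 = 1 + (k1 - k0) / k0 by field; rewrite gt_eqF.
  apply: le_ln1Dx; apply: (@lt_le_trans _ _ 0); first by lra.
  by rewrite divr_ge0 ?(ltW k0_gt0)// subr_ge0.
have lnk0 : 0 <= ln k1 - ln k0 by rewrite subr_ge0 ln_le.
have [u3|u3] := leP (3 * eps) (l1 - l0).
  apply: le_trans u3; apply: (@le_trans _ _ (ln k1 - ln k0)).
    by rewrite ler_piMl//; lra.
  by apply: (le_trans lnk); rewrite ler_pdivrMr.
have u0 : 0 <= l1 - l0 by rewrite subr_ge0.
have E1 : E * (1 - 3 * eps) <= expR (- l1).
  have -> : - l1 = - l0 + - (l1 - l0) by ring.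
  rewrite expRD ler_pM2l//.
  by have := expR_ge1Dx (- (l1 - l0)); lra.
set T1 := b * expR (- l1) in hz D2.
have T1T : T * (1 - 3 * eps) <= T1 by rewrite /T -mulrA ler_wpM2l.
have T10 : 0 <= T1 by rewrite mulr_ge0 ?expR_ge0.
have e2T1 : eps ^+ 2 * T1 <= eps / 1000 * T1 by rewrite ler_wpM2r.
have {}hz : (1 - 8 * eps) * T1 <= c m0 * (m1 - m0) * k1.
  by rewrite -mulrA [_ * k1]mulrC; apply: (le_trans _ hz); nra.
have zu : c m0 * (m1 - m0) <= (1 + 2 * eps) * (l1 - l0).
  have [_ + _] := Hc hm m01; rewrite mulrC => /le_trans; apply.
  by apply: excess_num => //; exact: ltW.
apply: (@le_trans _ _ ((1 - 20 * eps) * ((k1 - k0) / k0))).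
  by rewrite ler_pM2l.
rewrite mulrA ler_pdivrMr//.
exact: (zone1_num e0 e1 u0 k0_gt0 T0 T10 T1T hk1 r3 hz (ltW k1_gt0) zu).
Qed.

(** No concentration is used: each new excess is at most that of [y B], which is within [U] of the
    mean in the scale of [H]. When [z > 1 / 2], the trivial bound [l1 - l0 <= U] suffices, because
    then [r * W >= 1 / 2]. *)
Lemma zone2_incr_le U : 0 <= U -> B%:R * eps - l0 <= U ->
  l1 - l0 <= 4 / eps * (1 + U) * expR (eps * U) * ((k1 - k0) / k1).
Proof.
move=> U0 BU; have e0 := eps_gt0; have e1 := eps_small.
have hY : k1 * (m1 - m0) <= (k1 - k0) * (y B - m0).
  apply: excess_block_le_max => // i /andP[ni ni'].
  by apply: xB; rewrite ni' (leq_ltn_trans _ ni).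
have mB : m0 <= y B.
  apply: kept_mean_le => // i /andP[i0 ni]; apply: xB.
  by rewrite i0 (leq_trans ni).
have [_ h _] := Hc hm mB; rewrite Hy// in h.
have {}h : (y B - m0) * c m0 <= 2 / eps * expR (eps * U).
  apply: (le_trans h); rewrite mulrA [leRHS]mulrAC ler_pM2r ?invr_gt0//.
  have h1 : expR (eps * (B%:R * eps - l0)) <= expR (eps * U) by rewrite ler_expR ler_pM2l.
  by have := expR_gt0 (eps * U); nra.
have hu := incr_le_scaled_excess.
set z := c m0 * (m1 - m0) in hu.
pose r := (k1 - k0) / k1.
have r0 : 0 <= r by rewrite divr_ge0 ?(ltW k1_gt0)// subr_ge0.
pose W := 2 / eps * expR (eps * U).
have W0 : 0 <= W by rewrite mulr_ge0 ?expR_ge0// divr_ge0// ltW.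
have zr : z <= r * W.
  have -> : r * W = (k1 - k0) * W / k1 by rewrite /r; ring.
  rewrite ler_pdivlMr//.
  have -> : z * k1 = k1 * (m1 - m0) * c m0 by rewrite /z; ring.
  apply: (@le_trans _ _ ((k1 - k0) * (y B - m0) * c m0)).
    by rewrite ler_pM2r.
  by rewrite -mulrA ler_wpM2l// subr_ge0.
have -> : 4 / eps * (1 + U) * expR (eps * U) * ((k1 - k0) / k1) = 2 * (1 + U) * (r * W).
  by rewrite /r /W; ring.
have rW0 : 0 <= r * W by rewrite mulr_ge0.
have u0 : 0 <= l1 - l0 by rewrite subr_ge0.
have [z1|z1] := leP z (1 / 2).
  have : l1 - l0 <= 2 * z.
    have : (l1 - l0) * (1 / 2) <= (l1 - l0) * (1 - eps - eps * z).
      by rewrite ler_wpM2l//; nra.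
    lra.
  nra.
have uU : l1 - l0 <= U by apply: le_trans BU; rewrite lerD2r mean_le_top.
have : 1 / 2 <= r * W by rewrite (le_trans (ltW z1)).
nra.
Qed.
End block.

(** * Growth along the time grid *)

Section growth.
Context {R : realType}.

Lemma poly_le_expR (C lam : R) p : 0 <= C -> 0 < lam ->
  exists2 T : R, 0 <= T & forall t, T <= t -> C * (t + 1) ^+ p <= expR (lam * t).
Proof.
move=> C0 l0; pose F : R := p.+1`!%:R.
have F0 : 0 < F by rewrite ltr0n fact_gt0.
pose K := C * expR lam * F / lam ^+ p.+1.
have K0 : 0 <= K by rewrite divr_ge0 ?exprn_ge0 ?mulr_ge0 ?expR_ge0// ltW.
exists K => // t Kt; have t0 : 0 <= t + 1 by have := le_trans K0 Kt; lra.
have l1 : 0 <= lam * (t + 1) by rewrite mulr_ge0// ltW.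
have := expR_ge1Dxn p l1; rewrite -/F => h.
rewrite -(ler_pM2r (expR_gt0 lam)) -expRD.
have -> : lam * t + lam = lam * (t + 1) by ring.
have {}h : (lam * (t + 1)) ^+ p.+1 / F <= expR (lam * (t + 1)).
  by apply: le_trans h; rewrite lerDr.
apply: le_trans h.
rewrite ler_pdivlMr//.
have -> : C * (t + 1) ^+ p * expR lam * F = K * (t + 1) ^+ p * lam ^+ p.+1.
  by rewrite /K; field; rewrite gt_eqF// exprn_gt0.
rewrite exprMn [leRHS]mulrC ler_pM2r ?exprn_gt0// exprS ler_wpM2r ?exprn_ge0//; lra.
Qed.

Lemma subr_div_le_ln (k k' : R) : 0 < k -> k <= k' -> (k' - k) / k' <= ln k' - ln k.
Proof.
move=> k0 kk'; have k'0 := lt_le_trans k0 kk'.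
rewrite -lerN2 opprB -ln_div ?posrE//.
have -> : k / k' = 1 + - ((k' - k) / k') by field; rewrite gt_eqF.
apply: le_ln1Dx; rewrite ltrN2 ltr_pdivrMr//; lra.
Qed.

(* The increments of the second kind are charged to [W], the sum of the
   increments [k' - k] truncated at [C (j+1)^p]. *)
Lemma level_upper_bound (l k : nat -> R) (a C : R) (j0 p : nat) : 0 <= a -> 0 <= C ->
  (forall j, 1 <= k j) -> (forall j, k j <= k j.+1) ->
  (forall j, (j0 <= j)%N ->
     l j.+1 - l j <= a * ((k j.+1 - k j) / k j.+1) \/
     (l j.+1 - l j <= Num.sqrt j.+1%:R * ((k j.+1 - k j) / k j.+1) /\
      k j.+1 - k j <= C * j.+1%:R ^+ p)) ->
  exists K, forall j, (j0 <= j)%N ->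
    l j <= a * ln (k j) + K + 2 * Num.sqrt j%:R * ln (1 + C * j%:R ^+ p.+1).
Proof.
move=> a0 C0 k1 kk hl.
pose d i := Num.min (k i.+1 - k i) (C * i.+1%:R ^+ p).
pose W j := \sum_(j0 <= i < j) d i.
have d0 i : 0 <= d i by rewrite le_min subr_ge0 kk mulr_ge0 ?exprn_ge0.
have W0 j : 0 <= W j by apply: sumr_ge0.
have WS j : (j0 <= j)%N -> W j.+1 = W j + d j by move=> h; rewrite /W big_nat_recr.
have Wk j : (j0 <= j)%N -> W j <= k j.
  elim: j => [|j IH].
    by move=> _; rewrite /W big_geq// (le_trans ler01).
  rewrite leq_eqVlt => /predU1P[<-|]; first by rewrite /W big_geq// (le_trans ler01).
  rewrite ltnS => jj; rewrite WS//; have := IH jj.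
  have : d j <= k j.+1 - k j by rewrite /d ge_min lexx.
  lra.
(* This is the gain over [W <= k]: the total charge is [O(sqrt j ln j)], negligible against [ln n],
   which is of order [j]. *)
have WC j : (j0 <= j)%N -> W j <= C * j%:R ^+ p.+1.
  elim: j => [|j IH].
    by move=> _; rewrite /W big_geq// expr0n/= mulr0.
  rewrite leq_eqVlt => /predU1P[<-|].
    by rewrite /W big_geq// mulr_ge0 ?exprn_ge0.
  rewrite ltnS => jj; rewrite WS//; have := IH jj.
  have : d j <= C * j.+1%:R ^+ p by rewrite /d ge_min lexx orbT.
  have : C * j%:R ^+ p.+1 <= C * j.+1%:R ^+ p * j%:R.
    rewrite exprSr mulrA ler_wpM2r// ler_wpM2l// lerXn2r ?nnegrE//.
    by rewrite ler_nat.
  have -> : C * j.+1%:R ^+ p.+1 = C * j.+1%:R ^+ p * j%:R + C * j.+1%:R ^+ p.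
    by rewrite exprSr -{2}natr1; ring.
  lra.
have lnW j : 0 <= ln (1 + W j) by rewrite ln_ge0// lerDl.
pose K := l j0 - a * ln (k j0).
have key j : (j0 <= j)%N ->
    l j <= a * ln (k j) + K + 2 * Num.sqrt j%:R * ln (1 + W j).
  elim: j => [|j IH].
    rewrite leqn0 => /eqP jE; have := lnW 0%N; rewrite /K jE sqrtr0 mulr0 mul0r; lra.
  rewrite leq_eqVlt => /predU1P[<-|].
    have : 0 <= 2 * Num.sqrt j0%:R * ln (1 + W j0) by rewrite !mulr_ge0 ?sqrtr_ge0.
    rewrite /K; lra.
  rewrite ltnS => jj; have {}IH := IH jj.
  have kj0 : 0 < k j by rewrite (lt_le_trans ltr01).
  have kj1 : 0 < k j.+1 by rewrite (lt_le_trans ltr01).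
  have dln := subr_div_le_ln kj0 (kk j).
  have sq : Num.sqrt j%:R <= Num.sqrt j.+1%:R :> R by rewrite ler_wsqrtr// ler_nat.
  have s0 : 0 <= Num.sqrt j%:R :> R by rewrite sqrtr_ge0.
  have lnmono : ln (1 + W j) <= ln (1 + W j.+1).
    by rewrite ln_le// ?ltr_pwDl// lerD2l WS// lerDl.
  have step0 : Num.sqrt j%:R * ln (1 + W j) <= Num.sqrt j.+1%:R * ln (1 + W j).
    by rewrite ler_wpM2r.
  have [h|[h hC]] := hl _ jj.
    have : a * ((k j.+1 - k j) / k j.+1) <= a * (ln (k j.+1) - ln (k j)).
      by rewrite ler_wpM2l.
    have : Num.sqrt j.+1%:R * ln (1 + W j) <= Num.sqrt j.+1%:R * ln (1 + W j.+1).
      by rewrite ler_wpM2l// (le_trans s0).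
    lra.
  have dE : d j = k j.+1 - k j by rewrite /d min_l.
  have W1 : 0 < 1 + W j.+1 by rewrite ltr_pwDl.
  (* The factor 2 comes from [1 + W <= 2 k], as [W <= k] and [1 <= k]. *)
  have h2 : (k j.+1 - k j) / k j.+1 <= 2 * (ln (1 + W j.+1) - ln (1 + W j)).
    apply: (@le_trans _ _ (2 * ((1 + W j.+1 - (1 + W j)) / (1 + W j.+1)))); last first.
      rewrite ler_pM2l// subr_div_le_ln// ?ltr_pwDl// lerD2l WS// lerDl//.
    have -> : 1 + W j.+1 - (1 + W j) = k j.+1 - k j by rewrite WS// dE; ring.
    rewrite ler_pdivrMr// mulrA mulrAC ler_pdivlMr//.
    have : W j.+1 <= k j.+1 by apply: Wk; exact: leqW.
    have := k1 j.+1; have := kk j; nra.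
  have : Num.sqrt j.+1%:R * ((k j.+1 - k j) / k j.+1) <=
      Num.sqrt j.+1%:R * (2 * (ln (1 + W j.+1) - ln (1 + W j))).
    by rewrite ler_wpM2l// (le_trans s0).
  have : a * ln (k j) <= a * ln (k j.+1) by rewrite ler_wpM2l// ln_le.
  lra.
exists K => j jj; apply: (le_trans (key j jj)); rewrite lerD2l ler_wpM2l//.
by rewrite ln_le ?ltr_pwDl// lerD2l WC.
Qed.

(** The second alternative bounds [l] itself, not its increment: it resets the error to 0, and the
    first alternative never increases the error. *)
Lemma level_lower_bound (l k : nat -> R) (s : R) (j0 : nat) :
  (forall j, (j0 <= j)%N ->
     s * (ln (k j.+1) - ln (k j)) <= l j.+1 - l j \/ s * ln (k j.+1) <= l j.+1) ->
  exists2 K, 0 <= K & forall j, (j0 <= j)%N -> s * ln (k j) - K <= l j.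
Proof.
move=> hl; pose K := Num.max 0 (s * ln (k j0) - l j0).
have K0 : 0 <= K by rewrite le_max lexx.
exists K => //; elim=> [|j IH].
  rewrite leqn0 => /eqP jE; rewrite lerBlDl -lerBlDr /K jE le_max lexx orbT//.
rewrite leq_eqVlt => /predU1P[<-|].
  by rewrite lerBlDl -lerBlDr /K le_max lexx orbT.
rewrite ltnS => jj; have {IH} := IH jj; have [|] := hl _ jj; lra.
Qed.
End growth.

(** Rounded geometric growth; the [+ 1] keeps the sequence strictly increasing while it is below
    [M]. *)
Fixpoint grid_time (M j : nat) : nat :=
  if j is j'.+1 then (grid_time M j' + grid_time M j' %/ M + 1)%N else 1%N.

Section grid_time.
Context {R : realType} (M : nat).
Hypothesis M_gt0 : (0 < M)%N.
Local Notation nj := (grid_time M).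

Lemma grid_time_gt j : (j < nj j)%N.
Proof. by elim: j => //= j IH; rewrite addn1 ltnS (leq_trans IH)// leq_addr. Qed.

Lemma grid_time_gt0 j : (0 < nj j)%N.
Proof. exact: leq_ltn_trans (grid_time_gt j). Qed.

Lemma grid_time_incr j : (nj j < nj j.+1)%N.
Proof. by rewrite /= addn1 ltnS leq_addr. Qed.

Lemma grid_time_nondecr j j' : (j <= j')%N -> (nj j <= nj j')%N.
Proof.
elim: j' => [|j' IH]; first by rewrite leqn0 => /eqP ->.
rewrite leq_eqVlt => /predU1P[->//|]; rewrite ltnS => /IH /leq_trans; apply.
exact/ltnW/grid_time_incr.
Qed.

Lemma grid_timeS_le j : (nj j.+1 <= 3 * nj j)%N.
Proof. have := grid_time_gt0 j; have := leq_div (nj j) M => /=.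
by move: (nj j) (nj j %/ M)%N => u v; lia. Qed.

Lemma grid_step_ge j : M%:R^-1 * (nj j)%:R <= (nj j.+1)%:R - (nj j)%:R :> R.
Proof.
rewrite /= -addnA natrD addrAC subrr add0r mulrC ler_pdivrMr ?ltr0n//.
by rewrite -natrM ler_nat addn1 ltnW// ltn_ceil.
Qed.

Lemma grid_step_le j : (M <= j)%N ->
  (nj j.+1)%:R - (nj j)%:R <= 2 * M%:R^-1 * (nj j)%:R :> R.
Proof.
move=> Mj; rewrite /= -addnA natrD addrAC subrr add0r mulrAC ler_pdivlMr ?ltr0n//.
rewrite -natrM -natrM ler_nat mulnDl mul1n.
have := leq_trunc_div (nj j) M; have := grid_time_gt j.
by move: (nj j) (nj j %/ M)%N => u v; lia.
Qed.

(** With [ln_grid_time_ge], this shows that [j] and [ln n] have the same order, so powers of [j]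
    stand for powers of [ln n]. *)
Lemma ln_grid_time_le j : ln (nj j)%:R <= 2 * j%:R :> R.
Proof.
elim: j => [|j IH]; first by rewrite /= ln1 mulr0.
apply: (@le_trans _ _ (ln (3 * (nj j)%:R))).
  by rewrite ln_le ?ltr0n ?grid_time_gt0// -natrM ler_nat grid_timeS_le.
rewrite lnM ?posrE ?ltr0n ?grid_time_gt0// -(natr1 j) mulrDr mulr1.
by have := @le_ln1Dx R 2; rewrite (_ : 1 + 2 = 3 :> R); lra.
Qed.

Lemma ln_grid_time_ge j : ln (1 + M%:R^-1) * j%:R <= ln (nj j)%:R :> R.
Proof.
elim: j => [|j IH]; first by rewrite /= ln1 mulr0.
have i0 : 0 < M%:R^-1 :> R by rewrite invr_gt0 ltr0n.
have p0 : 0 < 1 + M%:R^-1 :> R by lra.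
have n0 : 0 < (nj j)%:R :> R by rewrite ltr0n grid_time_gt0.
apply: (@le_trans _ _ (ln ((1 + M%:R^-1) * (nj j)%:R))).
  by rewrite lnM ?posrE// -(natr1 j) mulrDr mulr1; lra.
apply: ln_le; first exact: mulr_gt0.
by rewrite mulrDl mul1r; have := grid_step_ge j; lra.
Qed.
End grid_time.

Arguments grid_time : simpl never.

Section near.
Context {R : realType}.

Lemma sqrt_expR_ln (u : R) : 0 < u -> Num.sqrt u = expR (ln u / 2).
Proof.
move=> u0; rewrite -[u in LHS]lnK ?posrE// [ln u in LHS]splitr expRD -expr2.
by rewrite sqrtr_sqr ger0_norm ?expR_ge0.
Qed.

Lemma near_le_nat (T : R) : \forall j \near \oo, T <= j%:R.
Proof. exact: nbhs_infty_ger. Qed.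

Lemma near_le_ln (T : R) : \forall j \near \oo, T <= ln j.+1%:R.
Proof.
near=> j; rewrite -[T]expRK ln_le ?expR_gt0//.
by rewrite (@le_trans _ _ j%:R) ?ler_nat//; near: j; exact: near_le_nat.
Unshelve. all: end_near. Qed.

Lemma near_poly_le_expR (C lam : R) p : 0 <= C -> 0 < lam ->
  \forall j \near \oo, C * j.+1%:R ^+ p <= expR (lam * j%:R).
Proof.
move=> C0 l0; have [T _ hT] := poly_le_expR p C0 l0.
near=> j; rewrite -natr1; apply: hT; near: j; exact: near_le_nat.
Unshelve. all: end_near. Qed.

Lemma near_ln_poly_le (C lam e : R) p : 0 <= C -> 0 < lam ->
  \forall j \near \oo, C * (ln j.+1%:R + 1) ^+ p <= expR (lam * ln j.+1%:R).
Proof.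
move=> C0 l0; have [T _ hT] := poly_le_expR p C0 l0.
near=> j; apply: hT; near: j; exact: near_le_ln.
Unshelve. all: end_near. Qed.
End near.

(** * Block estimates along a path with controlled counts *)

Section path.
Context {R : realType} (x y : nat -> R) (H c : R -> R) (M : nat) (m_ : R).
Local Notation eps := (M%:R^-1 : R).
Local Notation nj := (grid_time M).
Hypothesis M_big : (1000 <= M)%N.
Hypothesis H_nondecr : forall u v, u <= v -> H u <= H v.
Hypothesis Hy : forall a, (0 < a)%N -> H (y a) = a%:R * eps.
Hypothesis Hc : forall m v, m_ <= m -> m <= v ->
  [/\ 0 < c m,
     (v - m) * c m <= (1 + eps) * ((expR (eps * (H v - H m)) - 1) / eps) &
     (1 - eps) * ((1 - expR (- (eps * (H v - H m)))) / eps) <= (v - m) * c m].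
Hypothesis good : \forall j \near \oo, forall a, (0 < a <= j ^ 2)%N ->
  `|(exceed x y (nj j) a)%:R - (nj j)%:R * expR (- (a%:R * eps))| <=
  j%:R ^+ 2 * Num.sqrt (nj j)%:R * expR (- (a%:R * eps) / 2).

Let M_gt0 : (0 < M)%N. Proof. exact: leq_trans M_big. Qed.
Let MR_gt0 : 0 < M%:R :> R. Proof. by rewrite ltr0n. Qed.
Let eps_gt0 : 0 < eps. Proof. by rewrite invr_gt0. Qed.
Let eps_small : 1000 * eps <= 1.
Proof. by rewrite ler_pdivrMr// mul1r (ler_nat _ 1000). Qed.
Let Meps : M%:R * eps = 1. Proof. by rewrite divff// gt_eqF. Qed.
Let nj_gt0 j : 0 < (nj j)%:R :> R.
Proof. by rewrite ltr0n grid_time_gt0. Qed.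

Local Notation J j := (j.+1%:R : R).
Local Notation D j := (2 * J j ^+ 2 * Num.sqrt (nj j.+1)%:R : R).
Local Notation b j := ((nj j.+1)%:R - (nj j)%:R : R).

Lemma good_block : \forall j \near \oo, forall a, (0 < a <= j ^ 2)%N ->
  `|(exceed x y (nj j.+1) a)%:R - (exceed x y (nj j) a)%:R -
     b j * expR (- (a%:R * eps))| <= D j * expR (- (a%:R * eps) / 2) /\
  `|(exceed x y (nj j) a)%:R - (nj j)%:R * expR (- (a%:R * eps))| <=
    D j * expR (- (a%:R * eps) / 2).
Proof.
have [j0 _ hj] := good.
exists j0 => // j/= jj a /andP[a0 aj].
have h0 := hj j jj a; rewrite a0 aj in h0; have {}h0 := h0 isT.
have h1 := hj j.+1 (leqW jj) a; rewrite a0 in h1.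
have jJ2 : (j ^ 2 <= j.+1 ^ 2)%N by rewrite leq_sqr.
have {}h1 := h1 (leq_trans aj jJ2).
have w0 := expR_ge0 (- (a%:R * eps) / 2).
have sj : Num.sqrt (nj j)%:R <= Num.sqrt (nj j.+1)%:R :> R.
  by rewrite ler_wsqrtr// ler_nat ltnW// grid_time_incr.
have s0 : 0 <= Num.sqrt (nj j)%:R :> R by rewrite sqrtr_ge0.
have jJ : j%:R ^+ 2 <= J j ^+ 2 by rewrite lerXn2r ?nnegrE// ler_nat.
set w := expR (- _ / 2) in h0 h1 w0 *; set E := expR _ in h0 h1 *.
have h2 : j%:R ^+ 2 * Num.sqrt (nj j)%:R * w <= J j ^+ 2 * Num.sqrt (nj j.+1)%:R * w.
  by rewrite ler_wpM2r// ler_pM// sqr_ge0.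
have h3 : 0 <= J j ^+ 2 * Num.sqrt (nj j.+1)%:R * w.
  by rewrite mulr_ge0// mulr_ge0 ?sqr_ge0.
have -> : D j * w = 2 * (J j ^+ 2 * Num.sqrt (nj j.+1)%:R * w) by ring.
split; last lra.
rewrite mulrBl; move: h0 h1; rewrite !ler_norml => /andP[? ?] /andP[? ?]; apply/andP; split; lra.
Qed.

(** If the means stayed below [K], a fixed fraction of each late block would exceed [K + 1]; these
    items are kept with excess at least 1, while at most [n] items are kept in all. So the mean
    would grow by a fixed [dl] per block. *)
Lemma mean_large (K : R) : \forall j \near \oo, K <= kept_mean x (nj j).
Proof.
have [[j0 hj0]|nex] := pselect (exists j, K <= kept_mean x (nj j)).
  exists j0 => // j/= jj; apply: (le_trans hj0).
  by rewrite kept_mean_nondecr ?grid_time_gt0// grid_time_nondecr.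
exfalso.
have mK j : kept_mean x (nj j) < K.
  by rewrite ltNge; apply/negP => h; apply: nex; exists j.
pose a := (Num.truncn (`|H (K + 1)| * M%:R)).+1.
have ya : K + 1 <= y a.
  rewrite leNgt; apply/negP => /ltW/H_nondecr; rewrite Hy// leNgt => /negP; apply.
  rewrite ltr_pdivlMr//; apply: (@le_lt_trans _ _ (`|H (K + 1)| * M%:R)).
    by rewrite ler_pM2r// ler_norm.
  by rewrite truncnS_gt.
pose w := expR (- (a%:R * eps) / 2).
have w0 : 0 < w := expR_gt0 _.
have wE : expR (- (a%:R * eps)) = w ^+ 2 by rewrite expr2 -expRD -splitr.
(* A block has length at least [n / (3 M)] for its end [n], and half of the expected count is given
   up to the deviation. *)
pose dl := w ^+ 2 / (6 * M%:R).
have dl0 : 0 < dl by rewrite divr_gt0 ?exprn_gt0// mulr_gt0.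
have lam0 : 0 < ln (1 + eps) / 2 by rewrite divr_gt0// ln_gt0// ltrDl.
have C0 : 0 <= 12 * M%:R / w by rewrite divr_ge0 ?mulr_ge0// ltW.
have step : \forall j \near \oo,
    dl <= kept_mean x (nj j.+1) - kept_mean x (nj j).
  near=> j.
  have aj : (0 < a <= j ^ 2)%N.
    rewrite /=; apply: (@leq_trans j); last by rewrite -{1}(expn1 j) leq_pexp2l//; near: j; exists 1%N.
    by near: j; exists a.
  have hgood : forall a, (0 < a <= j ^ 2)%N ->
  `|(exceed x y (nj j.+1) a)%:R - (exceed x y (nj j) a)%:R -
     b j * expR (- (a%:R * eps))| <= D j * expR (- (a%:R * eps) / 2) /\
  `|(exceed x y (nj j) a)%:R - (nj j)%:R * expR (- (a%:R * eps))| <=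
    D j * expR (- (a%:R * eps) / 2) by near: j; exact: good_block.
  have [+ _] := hgood a aj; rewrite ler_distl => /andP[hN _].
  rewrite (exceedD _ _ (ltnW (grid_time_incr M j))) wE -/w in hN.
  have := @excess_block_ge _ x (nj j) (nj j.+1) (y a) (fun v => (y a < v)%R%:R)
    (grid_time_gt0 M j) (ltnW (grid_time_incr M j)).
  move=> /(_ _ _ _)h; have {}h := h _ _ _.
  have {}h : \sum_((nj j).+1 <= i < (nj j.+1).+1) (y a < x i)%R%:R <=
     (kept x (nj j.+1))%:R * (kept_mean x (nj j.+1) - kept_mean x (nj j)).
    apply: h.
    - by have := mK j.+1; lra.
    - by move=> v; rewrite leNgt => /negbTE ->.
    - by move=> v yv; rewrite yv/=; have := mK j; lra.
  have sJ : 12 * M%:R / w * J j ^+ 2 <= Num.sqrt (nj j.+1)%:R.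
    apply: (@le_trans _ _ (expR (ln (1 + eps) / 2 * j%:R))).
      by near: j; exact: near_poly_le_expR.
    rewrite sqrt_expR_ln// ler_expR mulrAC ler_pM2r ?invr_gt0//.
    apply: (le_trans (ln_grid_time_ge M_gt0 j)); rewrite ln_le// ler_nat.
    by rewrite ltnW// grid_time_incr.
  have kJ : (kept x (nj j.+1))%:R <= (nj j.+1)%:R :> R by rewrite ler_nat kept_le.
  have k0 : 0 < (kept x (nj j.+1))%:R :> R by rewrite ltr0n kept_gt0 ?grid_time_gt0.
  rewrite -(ler_pM2l k0); apply: le_trans h; apply: le_trans hN.
  apply: (@le_trans _ _ ((nj j.+1)%:R * dl)); first by rewrite ler_pM2r.
  have bge : (nj j.+1)%:R / (3 * M%:R) <= b j.
    apply: le_trans (grid_step_ge M_gt0 j).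
    rewrite [leRHS]mulrC invfM mulrA ler_pM2r// ler_pdivrMr// mulrC -natrM ler_nat.
    exact: grid_timeS_le.
  set s := Num.sqrt _ in sJ *.
  have sE : (nj j.+1)%:R = s * s by rewrite -expr2 sqr_sqrtr.
  have s0 : 0 < s by rewrite sqrtr_gt0.
  have bw : (nj j.+1)%:R / (3 * M%:R) * w ^+ 2 <= b j * w ^+ 2.
    by rewrite ler_pM2r// exprn_gt0.
  have sw : 12 * M%:R * J j ^+ 2 <= s * w.
    by rewrite -ler_pdivrMr// mulrAC.
  have d : D j * w <= s * s * dl.
    rewrite /dl (mulrA (s * s)) ler_pdivlMr ?mulr_gt0// -/s.
    have -> : 2 * J j ^+ 2 * s * w * (6 * M%:R) = s * w * (12 * M%:R * J j ^+ 2) by ring.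
    have -> : s * s * w ^+ 2 = s * w * (s * w) by ring.
    by rewrite ler_pM2l// mulr_gt0.
  have e3 : (nj j.+1)%:R / (3 * M%:R) * w ^+ 2 = 2 * (s * s * dl).
    by rewrite /dl sE; field; rewrite gt_eqF.
  have e4 : (nj j.+1)%:R * dl = s * s * dl by rewrite {1}sE.
  rewrite e4; move: bw d e3; set U1 := _ * w ^+ 2; set U2 := _ * w ^+ 2; set U3 := s * s * dl; set U4 := _ * w; lra.
have [j0 _ hj0] := step.
have lin i : kept_mean x (nj j0) + i%:R * dl <= kept_mean x (nj (j0 + i)).
  elim: i => [|i IH]; first by rewrite mul0r addr0 addn0.
  have := hj0 (j0 + i)%N (leq_addr _ _); rewrite addnS -(natr1 i); lra.
pose i := (Num.truncn (`|K - kept_mean x (nj j0)| / dl)).+1.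
have : K - kept_mean x (nj j0) < i%:R * dl.
  rewrite -ltr_pdivrMr//; apply: (@le_lt_trans _ _ (`|K - kept_mean x (nj j0)| / dl)).
    by rewrite ler_pM2r ?invr_gt0// ler_norm.
  by rewrite truncnS_gt.
have := lin i; have := mK (j0 + i)%N; lra.
Unshelve. all: end_near. Qed.

(** At this level the expected count is at most [1 / (4 j^4)] and the deviation allowed by [good] at
    most [1 / 2], so the count, an integer, is 0. *)
Definition top_index (n j : nat) : nat :=
  (Num.truncn (M%:R * (ln (n%:R : R) + ln (4 * j%:R ^+ 4)))).+1.

Local Notation B j := (top_index (nj j.+1) j.+1).

Lemma top_index_gt n j : ln (n%:R : R) + ln (4 * j%:R ^+ 4) <= (top_index n j)%:R * eps.
Proof.
by rewrite ler_pdivlMr// mulrC ltW// truncnS_gt.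
Qed.

Lemma ln4X4 j : ln (4 * J j ^+ 4) = ln 4 + 4 * ln (J j).
Proof. by rewrite lnM ?posrE ?exprn_gt0// lnXn// mulr_natl. Qed.

Lemma ln4X4_ge0 j : 0 <= ln (4 * J j ^+ 4).
Proof.
rewrite ln4X4 addr_ge0 ?mulr_ge0 ?ln_ge0//; first by rewrite (ler_nat _ 1).
by rewrite (ler_nat _ 1).
Qed.

Lemma top_index_le j : (top_index (nj j.+1) j.+1)%:R * eps <=
  ln (nj j.+1)%:R + ln (4 * J j ^+ 4) + eps.
Proof.
rewrite /top_index -natr1 mulrDl mul1r lerD2r ler_pdivrMr//.
rewrite [leRHS]mulrC truncn_le.
rewrite mulr_ge0 ?(ltW MR_gt0)// addr_ge0 ?ln4X4_ge0// ln_ge0//.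
by rewrite (ler_nat _ 1) grid_time_gt0.
Qed.

(** [B j] is of order [M j]; hence [j ^ 2] controlled levels leave room for the [M ^ 2] layers used
    in [excess_incr_ge]. *)
Lemma top_index_small : \forall j \near \oo, (B j + M ^ 2 + 1 <= j ^ 2)%N.
Proof.
exists (10 * M)%N => // j/= jM.
have h := top_index_le j; have hn := @ln_grid_time_le R M M_gt0 j.+1.
have hJ : ln (J j) <= j%:R.
  by have := @le_ln1Dx R j%:R; rewrite -(natr1 j) addrC; apply; have := ler0n R j; lra.
have h4 : ln 4 <= 3 :> R.
  by have := @le_ln1Dx R 3; rewrite (_ : 1 + 3 = 4 :> R); lra.
have : (B j)%:R <= (M * (6 * j + 6))%:R :> R.
  rewrite natrM [leRHS]mulrC -ler_pdivrMr// (le_trans h)//.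
  rewrite ln4X4 (natrD _ (6 * j)) natrM; rewrite -(natr1 j) in hn.
  have := eps_small; lra.
rewrite ler_nat => hB; rewrite expnS expn1; nia.
Qed.

Lemma top_exceed : \forall j \near \oo,
  forall i, (0 < i <= nj j.+1)%N -> x i <= y (B j).
Proof.
have [j0 _ hj0] := good; near=> j => i /andP[i0 ij].
have j0j : (j0 <= j)%N by near: j; exists j0.
have small : (B j + M ^ 2 + 1 <= j ^ 2)%N by near: j; exact: top_index_small.
have jJ2 : (j ^ 2 <= j.+1 ^ 2)%N by rewrite leq_sqr.
have Bj : (0 < B j <= j.+1 ^ 2)%N by rewrite /=; lia.
have := hj0 j.+1 (leqW j0j) _ Bj; rewrite ler_distl => /andP[_].
have := top_index_gt (nj j.+1) j.+1; set t := (B j)%:R * eps => ht.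
set n := (nj j.+1)%:R : R; have n0 : 0 < n := nj_gt0 _.
pose w := expR (- t / 2); have wE : expR (- t) = w * w by rewrite -expRD -splitr.
have w0 : 0 < w := expR_gt0 _.
rewrite -/w wE; set s := Num.sqrt n.
have s0 : 0 < s by rewrite sqrtr_gt0.
have sE : n = s * s by rewrite -expr2 sqr_sqrtr// ltW.
have J1 : 1 <= J j by rewrite (ler_nat _ 1).
have J0 : 0 < J j by [].
have key : n * (w * w) * (4 * J j ^+ 4) <= 1.
  rewrite -wE -[n]lnK ?posrE// -[4 * _]lnK ?posrE ?mulr_gt0 ?exprn_gt0//.
  by rewrite -!expRD -[leRHS]expR0 ler_expR; move: ht; rewrite -/n; lra.
have sw : 2 * (J j ^+ 2 * s * w) <= 1.
  rewrite -(@ler_pXn2r _ 2)// ?nnegrE ?mulr_ge0 ?sqr_ge0 ?(ltW w0) ?(ltW s0)//.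
  rewrite expr1n; apply: le_trans key; rewrite sE le_eqVlt.
  by apply/orP; left; apply/eqP; ring.
have n1 : 4 * (n * (w * w)) <= 1.
  apply: le_trans key; rewrite [leRHS]mulrC -mulrA ler_pM2l//.
  by rewrite ler_peMl ?exprn_ege1// !mulr_ge0 ?(ltW w0) ?(ltW n0).
move=> h; have {}h : (exceed x y (nj j.+1) (B j))%:R < 1%:R :> R.
  apply: le_lt_trans h _; rewrite -/n; lra.
rewrite ltr_nat ltnS leqn0 /exceed sum_nat_seq_eq0 in h.
have := allP h i; rewrite mem_index_iota i0 ltnS ij => /(_ isT) /=.
by rewrite leNgt; case: (_ < _).
Unshelve. all: end_near. Qed.

Local Notation l j := (H (kept_mean x (nj j))).
Local Notation k j := ((kept x (nj j))%:R : R).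
Local Notation Q := (36 * M%:R ^+ 6 : R).

Let expN_pow : expR (- eps) ^+ (M ^ 2) <= eps.
Proof.
rewrite -expRM_natl natrX mulrN expr2 -mulrA Meps mulr1.
apply: (le_trans (expRN_le (ltW MR_gt0))).
by rewrite lef_pV2 ?posrE ?ltr_pwDl// lerDr.
Qed.

(** Failure of the zone 1 condition bounds [sqrt n exp (- e / 2)] by [6 M^3 J^2], and squaring gives
    [Q]. The level [e] is free because the condition is tested at both ends of a block. *)
Lemma zone2_level (e : R) (j : nat) : 
  eps ^+ 2 * (b j * expR (- e / 2)) < D j ->
  (nj j.+1)%:R * expR (- e) <= Q * J j ^+ 4.
Proof.
move=> h; have bge : (nj j.+1)%:R / (3 * M%:R) <= b j.
  apply: le_trans (grid_step_ge M_gt0 j).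
  rewrite [leRHS]mulrC invfM mulrA ler_pM2r// ler_pdivrMr// mulrC -natrM ler_nat.
  exact: grid_timeS_le.
set w := expR (- e / 2) in h; have wE : expR (- e) = w * w by rewrite -expRD -splitr.
have w0 : 0 < w := expR_gt0 _.
set n := (nj j.+1)%:R in h bge *; have n0 : 0 < n := nj_gt0 _.
set s := Num.sqrt n in h; have s0 : 0 < s by rewrite sqrtr_gt0.
have sE : n = s * s by rewrite -expr2 sqr_sqrtr// ltW.
have {}h : eps ^+ 2 * (n / (3 * M%:R) * w) < 2 * J j ^+ 2 * s.
  apply: le_lt_trans h; rewrite ler_wpM2l ?sqr_ge0// ler_wpM2r ?(ltW w0)//.
have M3 : 0 < 3 * M%:R ^+ 3 :> R by rewrite mulr_gt0 ?exprn_gt0.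
have h2 : s * w <= 6 * M%:R ^+ 3 * J j ^+ 2.
  rewrite -(ler_pM2l s0) mulrA -sE.
  have -> : n * w = eps ^+ 2 * (n / (3 * M%:R) * w) * (3 * M%:R ^+ 3).
    by field; rewrite gt_eqF.
  apply: (@le_trans _ _ (2 * J j ^+ 2 * s * (3 * M%:R ^+ 3))).
    by rewrite ler_pM2r// ltW.
  by rewrite le_eqVlt; apply/orP; left; apply/eqP; ring.
rewrite wE sE.
have -> : s * s * (w * w) = (s * w) ^+ 2 by ring.
have -> : Q * J j ^+ 4 = (6 * M%:R ^+ 3 * J j ^+ 2) ^+ 2 by ring.
rewrite lerXn2r// nnegrE ?mulr_ge0 ?exprn_ge0 ?(ltW w0) ?(ltW s0)//.
Qed.

(** All that the growth argument needs: the first two parts drive the upper and the lower bound on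
    [H m], the third bounds the newly kept items, and the last bounds [k] below by [n exp (- H m)]
    up to a power of [j]. *)
Lemma block_facts : \forall j \near \oo,
  [/\ l j.+1 - l j <= (1 + 20 * eps) * ((k j.+1 - k j) / k j.+1) \/
        (l j.+1 - l j <= Num.sqrt (J j) * ((k j.+1 - k j) / k j.+1) /\
         (nj j.+1)%:R * expR (- l j) <= Q * J j ^+ 4),
      (1 - 20 * eps) * (ln (k j.+1) - ln (k j)) <= l j.+1 - l j \/
         (nj j.+1)%:R * expR (- l j.+1) <= Q * J j ^+ 4,
      k j.+1 - k j <= 4 * J j ^+ 2 * (1 + (nj j.+1)%:R * expR (- l j)) &
      (nj j)%:R * expR (- l j) <= 68 * J j ^+ 4 * k j].
Proof.
pose C0 : R := ln 4 + ln Q + 1.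
have Q1 : 1 <= Q.
  have : 1 <= M%:R ^+ 6 :> R by rewrite exprn_ege1// (ler_nat _ 1).
  lra.
have Q0 : 0 < Q := lt_le_trans ltr01 Q1.
have lnQJ j : ln (Q * J j ^+ 4) = ln Q + 4 * ln (J j).
  have Jp : 0 < J j ^+ 4 by rewrite exprn_gt0.
  by rewrite (lnM (Q0 : Q \in Num.pos) (Jp : _ \in Num.pos)) lnXn// -[_ *+ 4]mulr_natl.
have C0_ge0 : 0 <= C0.
  have h4 := ln_ge0 Q1; have h5 : 0 <= ln 4 :> R by rewrite ln_ge0// (ler_nat _ 1).
  by rewrite /C0; lra.
have C1_ge0 : 0 <= 4 * M%:R * (8 + (1 + C0)) * expR C0.
  have m8 : 0 <= 8 + (1 + C0) by lra.
  by apply: mulr_ge0 (expR_ge0 _); apply: mulr_ge0 => //; rewrite mulr_ge0.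
have lam0 : 0 < 49 / 100 :> R by lra.
near=> j.
have hgood : forall a, (0 < a <= j ^ 2)%N ->
  `|(exceed x y (nj j.+1) a)%:R - (exceed x y (nj j) a)%:R -
     b j * expR (- (a%:R * eps))| <= D j * expR (- (a%:R * eps) / 2) /\
  `|(exceed x y (nj j) a)%:R - (nj j)%:R * expR (- (a%:R * eps))| <=
    D j * expR (- (a%:R * eps) / 2) by near: j; exact: good_block.
have hB a h := (hgood a h).1; have hC a h := (hgood a h).2.
have xB : forall i, (0 < i <= nj j.+1)%N -> x i <= y (B j).
  by near: j; exact: top_exceed.
have small : (B j + M ^ 2 + 1 <= j ^ 2)%N by near: j; exact: top_index_small.
have small1 : (B j < j ^ 2)%N by clear -small; lia.
have Mj : (M <= j)%N by near: j; exists M.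
have hm : m_ <= kept_mean x (nj j) by near: j; exact: mean_large.
have hl0 : eps <= l j.
  rewrite -[eps]mul1r -(Hy (ltn0Sn 0)); apply: H_nondecr.
  by near: j; exact: mean_large.
have n0 := grid_time_gt0 M j; have nn := ltnW (grid_time_incr M j).
have J0 : 0 < J j by [].
have J1 : 1 <= J j by rewrite (ler_nat _ 1).
have D0 : 0 <= D j by rewrite mulr_ge0 ?sqrtr_ge0// mulr_ge0 ?sqr_ge0.
have bge := @grid_step_ge R M M_gt0 j; have ble := @grid_step_le R M M_gt0 j Mj.
have k0 : 0 < k j by rewrite ltr0n kept_gt0.
have k1 : 1 <= k j by rewrite (ler_nat _ 1) kept_gt0.
have Z2 e : D j <= eps ^+ 2 * (b j * expR (- e / 2)) \/
    (nj j.+1)%:R * expR (- e) <= Q * J j ^+ 4.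
  have [?|h] := leP (D j) (eps ^+ 2 * (b j * expR (- e / 2))); first by left.
  by right; exact: zone2_level.
split.
- have [h|h] := Z2 (l j).
    left; have [] := zone1_incr_le eps_gt0 eps_small H_nondecr Hy Hc n0 nn D0
      hB hC hm hl0 (ltn0Sn _) xB small1 bge ble h => _ _; exact.
  right; split => //.
  (* The top level exceeds [ln n] by at most [ln 4 + 4 ln J + eps], and [ln n] exceeds [l j] by at
     most [ln Q + 4 ln J]. *)
  pose U := C0 + 8 * ln (J j).
  have lnJ0 : 0 <= ln (J j) by rewrite ln_ge0.
  have U0 : 0 <= U by rewrite addr_ge0// mulr_ge0.
  have BU : (B j)%:R * eps - l j <= U.
    have := top_index_le j; rewrite ln4X4 => h1.
    have : ln ((nj j.+1)%:R * expR (- l j)) <= ln (Q * J j ^+ 4).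
      by apply: ln_le h; rewrite mulr_gt0 ?expR_gt0.
    rewrite (lnM (nj_gt0 _ : _ \in Num.pos)) ?posrE ?expR_gt0// expRK lnQJ => h2.
    have := eps_small; rewrite /U /C0; lra.
  have := zone2_incr_le eps_gt0 eps_small H_nondecr Hy Hc n0 nn hm (ltn0Sn _) xB U0 BU.
  move=> /le_trans; apply; rewrite ler_wpM2r//.
    by rewrite divr_ge0// subr_ge0 ler_nat kept_nondecr.
  rewrite sqrt_expR_ln// invrK.
  (* As [8 eps <= 1 / 100], this is a small power of [J]; the remaining [J ^ (49 / 100)] of [sqrt J]
     absorbs the constants and the logarithm. *)
  have e1 : expR (eps * U) <= expR C0 * expR (ln (J j) / 100).
    by rewrite -expRD ler_expR /U; have := eps_small; have := eps_gt0; nra.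
  apply: (@le_trans _ _ (4 * M%:R * (1 + U) * (expR C0 * expR (ln (J j) / 100)))).
    by rewrite ler_wpM2l// !mulr_ge0 ?(ltW MR_gt0)//; lra.
  have -> : ln (J j) / 2 = 49 / 100 * ln (J j) + ln (J j) / 100 by lra.
  rewrite [leRHS]expRD [leLHS]mulrA ler_pM2r ?expR_gt0//.
  apply: (@le_trans _ _ (4 * M%:R * (8 + (1 + C0)) * expR C0 * (ln (J j) + 1) ^+ 1)); last first.
    by near: j; exact: near_ln_poly_le.
  rewrite expr1 [leRHS]mulrAC ler_pM2r ?expR_gt0// -[leRHS]mulrA ler_wpM2l//.
  rewrite /U; nra.
- have [h|h] := Z2 (l j.+1); last by right.
  left; exact: (zone1_incr_ge eps_gt0 eps_small H_nondecr Hy Hc n0 nn D0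
      hB hC hm hl0 (ltn0Sn _) xB small expN_pow bge ble h).
- have := kept_incr_le eps_gt0 H_nondecr Hy Hc n0 nn D0
      hB hm hl0 (ltn0Sn _) xB (ltnW small1).
  move=> /le_trans; apply.
  set n := (nj j.+1)%:R : R; have nR0 : 0 < n := nj_gt0 _.
  set s := Num.sqrt n; have s0 : 0 < s by rewrite sqrtr_gt0.
  have sE : n = s * s by rewrite -expr2 sqr_sqrtr// ltW.
  pose w := expR (- l j / 2); have w0 : 0 < w := expR_gt0 _.
  have wE : expR (- l j) = w * w by rewrite -expRD -splitr.
  have e0 := eps_gt0; have es := eps_small.
  have x1 : expR (- l j + eps) <= w * w * 2.
    rewrite -wE expRD ler_pM2l ?expR_gt0//.
    by apply: (le_trans (expR_small _ _)); lra.
  have x2 : expR ((- l j + eps) / 2) <= w * 2.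
    rewrite mulrDl expRD ler_pM2l ?expR_gt0//.
    by apply: (le_trans (expR_small _ _)); lra.
  have b0 : 0 <= b j by rewrite subr_ge0 ler_nat.
  have bn : b j <= n by rewrite gerBl.
  have y1 : b j * expR (- l j + eps) <= n * (w * w * 2).
    by apply: ler_pM => //; exact: expR_ge0.
  have y2 : D j * expR ((- l j + eps) / 2) <= D j * (w * 2) by rewrite ler_wpM2l.
  apply: (le_trans (lerD y1 y2)); rewrite wE sE -/n -/s.
  have J2 : 1 <= J j ^+ 2 by rewrite exprn_ege1.
  set v := s * w.
  have -> : s * s * (w * w * 2) = 2 * v ^+ 2 by rewrite /v; ring.
  have -> : 2 * J j ^+ 2 * s * (w * 2) = 4 * J j ^+ 2 * v by rewrite /v; ring.
  have -> : s * s * (w * w) = v ^+ 2 by rewrite /v; ring.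
  have v2 : 2 * v <= 1 + v ^+ 2 by have := sqr_ge0 (v - 1); rewrite !expr2; lra.
  have v0 : 0 <= v ^+ 2 by rewrite sqr_ge0.
  nra.
- have := kept_start_ge eps_gt0 H_nondecr Hy n0 nn D0
      hC hl0 (ltn0Sn _) xB small1.
  set n := (nj j)%:R : R; have nR0 : 0 < n := nj_gt0 _.
  set s := Num.sqrt n; have s0 : 0 < s by rewrite sqrtr_gt0.
  have sE : n = s * s by rewrite -expr2 sqr_sqrtr// ltW.
  have sJ : Num.sqrt (nj j.+1)%:R <= 2 * s.
    have -> : 2 * s = Num.sqrt (4 * n).
      rewrite sqrtrM// -/s; congr (_ * _).
      by rewrite (_ : 4 = 2 ^+ 2 :> R) ?sqrtr_sqr ?ger0_norm//; ring.
    rewrite ler_wsqrtr// -natrM ler_nat (leq_trans (grid_timeS_le M_gt0 j))//.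
    by rewrite leq_mul2r orbT.
  pose w := expR (- l j / 2); have w0 : 0 < w := expR_gt0 _.
  have wE : expR (- l j) = w * w by rewrite -expRD -splitr.
  have e0 := eps_gt0; have es := eps_small.
  have x1 : w * w * (1 / 2) <= expR (- l j - eps).
    rewrite -wE expRD ler_pM2l ?expR_gt0//.
    by have := expR_ge1Dx (- eps); lra.
  have x2 : D j * w <= 2 * J j ^+ 2 * (2 * s) * w.
    by rewrite ler_pM2r// ler_wpM2l// mulr_ge0 ?sqr_ge0.
  have x3 : n * (w * w * (1 / 2)) <= n * expR (- l j - eps) by rewrite ler_pM2l.
  rewrite -/w wE sE; set v := s * w => hk.
  have h1 : s * s * (w * w * (1 / 2)) - 2 * J j ^+ 2 * (2 * s) * w <= k j.
    by apply: le_trans hk; apply: lerB x2; rewrite -sE; exact: x3.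
  have {}h1 : v ^+ 2 / 2 - 4 * J j ^+ 2 * v <= k j.
    by apply: le_trans h1; rewrite le_eqVlt; apply/orP; left; apply/eqP; rewrite /v; ring.
  have -> : s * s * (w * w) = v ^+ 2 by rewrite /v; ring.
  have -> : J j ^+ 4 = J j ^+ 2 * J j ^+ 2 by ring.
  have J2 : 1 <= J j ^+ 2 by rewrite exprn_ege1.
  set q := J j ^+ 2 in h1 J2 *.
  have q4 : 1 <= q * q by nra.
  (* Completing the square gives [4 q v <= v^2 / 4 + 16 q^2], so [v^2 <= 4 k + 64 q^2]; hence
     [68 = 4 + 64]. *)
  have sq : 0 <= (v - 8 * q) ^+ 2 by rewrite sqr_ge0.
  have qk : k j <= q * q * k j by rewrite ler_peMl// ltW.
  have qq : q * q <= q * q * k j by rewrite ler_peMr//; nra.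
  rewrite expr2 in sq; rewrite expr2 in h1 *; nra.
Unshelve. all: end_near. Qed.
End path.

(** * From the growth of [H m] to the exponent of the number of kept items *)

Section exponents.
Context {R : realType} (M : nat) (k l : nat -> R).
Local Notation eps := (M%:R^-1 : R).
Local Notation nj := (grid_time M).
Local Notation N j := ((nj j)%:R : R).
Local Notation J j := (j.+1%:R : R).
Local Notation Q := (36 * M%:R ^+ 6 : R).
Hypothesis M_big : (1000 <= M)%N.
Hypothesis k_ge1 : forall j, 1 <= k j.
Hypothesis k_nondecr : forall j, k j <= k j.+1.
Hypothesis kN : forall j, k j <= N j.
Hypothesis facts : \forall j \near \oo,
  [/\ l j.+1 - l j <= (1 + 20 * eps) * ((k j.+1 - k j) / k j.+1) \/
        (l j.+1 - l j <= Num.sqrt (J j) * ((k j.+1 - k j) / k j.+1) /\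
         N j.+1 * expR (- l j) <= Q * J j ^+ 4),
      (1 - 20 * eps) * (ln (k j.+1) - ln (k j)) <= l j.+1 - l j \/
         N j.+1 * expR (- l j.+1) <= Q * J j ^+ 4,
      k j.+1 - k j <= 4 * J j ^+ 2 * (1 + N j.+1 * expR (- l j)) &
      N j * expR (- l j) <= 68 * J j ^+ 4 * k j].

Let M_gt0 : (0 < M)%N. Proof. exact: leq_trans M_big. Qed.
Let eps_gt0 : 0 < eps. Proof. by rewrite invr_gt0 ltr0n. Qed.
Let eps_small : 1000 * eps <= 1.
Proof. by rewrite ler_pdivrMr ?ltr0n// mul1r (ler_nat _ 1000). Qed.
Let N_gt0 j : 0 < N j. Proof. by rewrite ltr0n grid_time_gt0. Qed.
Let k_gt0 j : 0 < k j. Proof. exact: lt_le_trans (k_ge1 j). Qed.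
Let J_ge1 j : 1 <= J j. Proof. by rewrite (ler_nat _ 1). Qed.
Let lnJ_ge0 j : 0 <= ln (J j). Proof. exact: ln_ge0. Qed.

Lemma near_sqrt_ln_small (C e : R) : 0 <= C -> 0 < e ->
  \forall j \near \oo, C * (ln (J j) + 1) * Num.sqrt (J j) <= e * ln (N j).
Proof.
move=> C0 e0; pose lam : R := ln (1 + eps).
have lam0 : 0 < lam by rewrite ln_gt0// ltrDl.
pose C1 := C / (e * lam / 2).
have d0 : 0 < e * lam / 2 by rewrite !mulr_gt0.
have C10 : 0 <= C1 by rewrite divr_ge0// ltW.
near=> j.
have j1 : (1 <= j)%N by near: j; exists 1%N.
have h : C1 * (ln (J j) + 1) ^+ 1 <= expR (1 / 2 * ln (J j)).
  by near: j; apply: near_ln_poly_le => //; lra.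
rewrite expr1 /C1 mulrAC ler_pdivrMr// in h.
apply: (@le_trans _ _ (e * (lam * j%:R))); last first.
  by rewrite ler_pM2l// ln_grid_time_ge.
have sE : Num.sqrt (J j) = expR (1 / 2 * ln (J j)).
  by rewrite sqrt_expR_ln//; congr expR; lra.
have s0 : 0 <= Num.sqrt (J j) by rewrite sqrtr_ge0.
apply: (le_trans (ler_wpM2r s0 h)).
rewrite -sE mulrAC -expr2 sqr_sqrtr//.
have jJ : J j <= 2 * j%:R by rewrite -natrM ler_nat; clear -j1; lia.
have -> : e * (lam * j%:R) = 2 * j%:R * (e * lam / 2) by lra.
by rewrite ler_pM2r.
Unshelve. all: end_near. Qed.

Lemma near_ln_small (C e : R) : 0 <= C -> 0 < e ->
  \forall j \near \oo, C * (ln (J j) + 1) <= e * ln (N j).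
Proof.
move=> C0 e0; near=> j.
apply: (@le_trans _ _ (C * (ln (J j) + 1) * Num.sqrt (J j))).
  rewrite ler_peMr//; first by rewrite mulr_ge0// addr_ge0.
  by rewrite -[leLHS]sqrtr1 ler_wsqrtr.
by near: j; exact: near_sqrt_ln_small.
Unshelve. all: end_near. Qed.

Let ln_le_start j : N j * expR (- l j) <= 68 * J j ^+ 4 * k j ->
  ln (N j) - l j <= ln 68 + 4 * ln (J j) + ln (k j).
Proof.
move=> h; have x0 : 0 < N j * expR (- l j) by rewrite mulr_gt0 ?expR_gt0.
have := ln_le x0 h.
have p0 : 0 < J j ^+ 4 by rewrite exprn_gt0.
have p1 : 0 < 68 * J j ^+ 4 by rewrite mulr_gt0.
have p2 : 0 < expR (- l j) by exact: expR_gt0.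
have p3 : 0 < 68 :> R by [].
rewrite (lnM (N_gt0 j : _ \in Num.pos) (p2 : _ \in Num.pos)) expRK.
rewrite (lnM (p1 : _ \in Num.pos) (k_gt0 j : _ \in Num.pos)).
rewrite (lnM (p3 : _ \in Num.pos) (p0 : _ \in Num.pos)) lnXn//.
by rewrite -[_ *+ 4]mulr_natl.
Qed.

(** The sum of [H m <= (1 + 20 eps) ln k + o(ln n)], from [level_upper_bound], and
    [ln n - H m <= ln k + o(ln n)], from the last part of [facts]. *)
Lemma ln_time_le : \forall j \near \oo,
  (1 - eps) * ln (N j) <= (2 + 20 * eps) * ln (k j).
Proof.
have [j0 _ hj0] := facts.
have Q0 : 0 <= Q by rewrite mulr_ge0 ?exprn_ge0.
pose C : R := 4 * (1 + Q).
have C0 : 0 <= C by rewrite mulr_ge0// addr_ge0.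
have a0 : 0 <= 1 + 20 * eps by have := eps_gt0; lra.
(* The degree 6 is that of [J^2 (1 + Q J^4)], which bounds the newly kept items in a block of the
   second kind. *)
have [|K hK] := @level_upper_bound R l k (1 + 20 * eps) C j0 6 a0 C0 k_ge1 k_nondecr.
  move=> j jj; have [+ _ h3 _] := hj0 j jj.
  move=> [h|[h h2]]; [by left|right; split => //].
  apply: (le_trans h3).
  have J2 : 0 <= 4 * J j ^+ 2 by rewrite mulr_ge0 ?exprn_ge0.
  apply: (@le_trans _ _ (4 * J j ^+ 2 * ((1 + Q) * J j ^+ 4))).
    rewrite ler_wpM2l// mulrDl mul1r lerD//.
    by rewrite exprn_ege1.
  by rewrite le_eqVlt; apply/orP; left; apply/eqP; rewrite /C; ring.
have lnC : 0 <= ln (1 + C) by rewrite ln_ge0// lerDl.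
have ln68 : 0 <= ln 68 :> R by rewrite ln_ge0// (ler_nat _ 1).
pose C' := `|K| + ln 68 + 4 + 2 * ln (1 + C) + 14.
have C'0 : 0 <= C' by rewrite /C' !addr_ge0// mulr_ge0.
near=> j.
have jj : (j0 <= j)%N by near: j; exists j0.
have {}hK := hK j jj; have [_ _ _ /ln_le_start h4] := hj0 j jj.
have hs : C' * (ln (J j) + 1) * Num.sqrt (J j) <= eps * ln (N j).
  by near: j; exact: near_sqrt_ln_small.
set s := Num.sqrt (J j) in hs.
have s1 : 1 <= s by rewrite -[leLHS]sqrtr1 ler_wsqrtr.
have hln : ln (1 + C * j%:R ^+ 7) <= ln (1 + C) + 7 * ln (J j).
  have J7 : 0 < J j ^+ 7 by rewrite exprn_gt0.
  have C1 : 0 < 1 + C by rewrite ltr_pwDl.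
  have -> : ln (1 + C) + 7 * ln (J j) = ln ((1 + C) * J j ^+ 7).
    by rewrite (lnM (C1 : _ \in Num.pos) (J7 : _ \in Num.pos)) lnXn// [in LHS]mulr_natl.
  apply: ln_le; first by rewrite ltr_pwDl// mulr_ge0 ?exprn_ge0.
  rewrite mulrDl mul1r lerD ?exprn_ege1// ler_wpM2l// lerXn2r ?nnegrE//.
  by rewrite ler_nat.
have sj : Num.sqrt j%:R <= s by rewrite ler_wsqrtr// ler_nat.
have s0 : 0 <= Num.sqrt j%:R :> R by rewrite sqrtr_ge0.
have hprod : 2 * Num.sqrt j%:R * ln (1 + C * j%:R ^+ 7) <=
    2 * s * (ln (1 + C) + 7 * ln (J j)).
  have q1 : 0 <= 2 * Num.sqrt j%:R :> R by rewrite mulr_ge0.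
  have q2 : 0 <= ln (1 + C * j%:R ^+ 7).
    by rewrite ln_ge0// lerDl mulr_ge0// exprn_ge0.
  have q3 : 2 * Num.sqrt j%:R <= 2 * s by rewrite ler_pM2l.
  exact: ler_pM.
have KK := ler_norm K.
set t := ln (J j) in hs hprod h4.
have t0 : 0 <= t by exact: lnJ_ge0.
have e1 : `|K| + ln 68 + 4 * t <= (`|K| + ln 68 + 4) * (t + 1) * s.
  apply: (@le_trans _ _ ((`|K| + ln 68 + 4) * (t + 1))).
    have : 0 <= (`|K| + ln 68) * t by rewrite mulr_ge0// addr_ge0.
    by rewrite mulrDl mulrDr mulr1; lra.
  by rewrite ler_peMr// mulr_ge0 ?addr_ge0.
have e2 : 2 * s * (ln (1 + C) + 7 * t) <= (2 * ln (1 + C) + 14) * (t + 1) * s.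
  have : 0 <= s * (ln (1 + C) * t) by rewrite mulr_ge0 ?(le_trans ler01 s1)// mulr_ge0.
  have : 0 <= s by lra.
  by lra.
have e3 : C' * (t + 1) * s = (`|K| + ln 68 + 4) * (t + 1) * s +
   (2 * ln (1 + C) + 14) * (t + 1) * s by rewrite /C'; ring.
move: hs hprod h4 hK e1 e2 e3.
set u1 := _ * s; set u2 := _ * s; set u3 := _ * s.
rewrite !mulrDl !mul1r mulNr; lra.
Unshelve. all: end_near. Qed.

(** From [H m >= s ln k - K] it follows that [n exp (- H m)] is at most [G], roughly
    [n ^ (1 / (1 + s))]. Newly kept items number at most [16 J^2 G] per block and [G] is
    nondecreasing, so summing over [j] blocks costs only a power of [j]. *)
Lemma ln_time_ge : \forall j \near \oo,
  (2 - 20 * eps) * ln (k j) <= (1 + eps) * ln (N j).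
Proof.
pose s := 1 - 20 * eps.
have s0 : 0 < s by rewrite /s; have := eps_small; lra.
have s1 : s <= 1 by rewrite /s; have := eps_gt0; lra.
have Q1 : 1 <= Q.
  have : 1 <= M%:R ^+ 6 :> R by rewrite exprn_ege1// (ler_nat _ 1).
  lra.
have lnQ := ln_ge0 Q1.
have ln68 : 0 <= ln 68 :> R by rewrite ln_ge0// (ler_nat _ 1).
have [j1 _ hj1] : \forall j \near \oo, (ln Q + 4) * (ln (J j) + 1) <= 20 * eps * ln (N j).
  by apply: near_ln_small; rewrite ?addr_ge0// mulr_gt0.
have [j0 _ hj0] := facts.
have [|K K0 hK] := @level_lower_bound R l k s (maxn j0 j1).
  move=> j; rewrite geq_max => /andP[jj0 jj1].
  have [_ [h|h] _ _] := hj0 j jj0; [by left|right].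
  (* With few exceedances the level is at least [ln n - O(ln j)]; then [k <= n] suffices, and
     [20 eps ln n] pays for the loss. *)
  apply: (@le_trans _ _ (s * ln (N j.+1))); first by rewrite ler_pM2l// ln_le.
  have p2 : 0 < expR (- l j.+1) by exact: expR_gt0.
  have p0 : 0 < J j ^+ 4 by rewrite exprn_gt0.
  have p1 : 0 < Q by exact: lt_le_trans Q1.
  have := ln_le (mulr_gt0 (N_gt0 _) p2) h.
  rewrite (lnM (N_gt0 _ : _ \in Num.pos) (p2 : _ \in Num.pos)) expRK.
  rewrite (lnM (p1 : _ \in Num.pos) (p0 : _ \in Num.pos)) lnXn//.
  rewrite -[_ *+ 4]mulr_natl => hl.
  have := hj1 j jj1 => /= hs.
  have NN : ln (N j) <= ln (N j.+1).
    by rewrite ln_le// ler_nat ltnW// grid_time_incr.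
  have : 20 * eps * ln (N j) <= 20 * eps * ln (N j.+1) by rewrite ler_pM2l// mulr_gt0.
  have t0 := lnJ_ge0 j; set t := ln (J j) in hs hl t0.
  have : 0 <= ln Q * t by rewrite mulr_ge0.
  rewrite mulrDl !mulrDr !mulr1 in hs.
  rewrite /s mulrBl mul1r; lra.
pose j2 := maxn j0 j1.
pose C2 := K + ln 68.
have C20 : 0 <= C2 by rewrite addr_ge0.
(* Adding [s (ln n - H m) <= s ln k + ln 68 + 4 ln J] and [s ln k <= H m + K] eliminates [k] and
   leaves [(1 + s) (ln n - H m) <= ln n + C2 + 4 ln J]. *)
pose G j := expR ((ln (N j) + C2 + 4 * ln (J j)) / (1 + s)).
have s2 : 0 < 1 + s by lra.
have lnN0 j : 0 <= ln (N j) by rewrite ln_ge0// (ler_nat _ 1) grid_time_gt0.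
have G1 j : 1 <= G j.
  have := lnJ_ge0 j; have := lnN0 j => u1 u2.
  by rewrite -[leLHS]expR0 ler_expR divr_ge0 ?(ltW s2)//; lra.
have GG j : G j <= G j.+1.
  rewrite ler_expR ler_pM2r ?invr_gt0//.
  have : ln (J j) <= ln (J j.+1) by rewrite ln_le// ler_nat.
  have : ln (N j) <= ln (N j.+1).
    by rewrite ln_le// ler_nat ltnW// grid_time_incr.
  lra.
have xG j : (j2 <= j)%N -> N j * expR (- l j) <= G j.
  move=> jj; have {}hK := hK j jj.
  have jj0 : (j0 <= j)%N by apply: leq_trans jj; exact: leq_maxl.
  have [_ _ _ /ln_le_start h4] := hj0 j jj0.
  rewrite -[N j]lnK ?posrE// -expRD ler_expR ler_pdivlMr//.
  have t0 := lnJ_ge0 j.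
  have a1 : s * (ln (N j) - l j) <= s * (ln 68 + 4 * ln (J j) + ln (k j)).
    by rewrite ler_pM2l.
  have a2 : s * (ln 68 + 4 * ln (J j)) <= ln 68 + 4 * ln (J j).
    by rewrite ler_piMl// addr_ge0// mulr_ge0.
  have aE (u v w : R) : s * (u + v + w) = s * (u + v) + s * w by ring.
  have bE (u : R) : u * (1 + s) = u + s * u by ring.
  rewrite aE in a1; rewrite bE /C2.
  move: a1 a2 hK; set u1 := s * (_ - _); set u2 := s * (_ + _); set u3 := s * ln (k j).
  lra.
have kG j : (j2 <= j)%N -> k j <= (k j2 + 16 * j%:R ^+ 3) * G j.
  elim: j => [|j IH].
    rewrite leqn0 => /eqP ->; rewrite expr0n/= mulr0 addr0.
    by rewrite ler_peMr// ltW.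
  rewrite leq_eqVlt => /predU1P[<-|].
    apply: (@le_trans _ _ (k j2 * G j2)); first by rewrite ler_peMr// ltW.
    by rewrite ler_wpM2r ?expR_ge0// lerDl mulr_ge0 ?exprn_ge0.
  rewrite ltnS => jj; have {}IH := IH jj; have {}xG := xG j jj.
  have jj0 : (j0 <= j)%N by apply: leq_trans jj; exact: leq_maxl.
  have [_ _ h3 _] := hj0 j jj0.
  have N3 : N j.+1 * expR (- l j) <= 3 * G j.
    apply: (@le_trans _ _ (3 * (N j * expR (- l j)))); last by rewrite ler_pM2l.
    rewrite mulrA ler_pM2r ?expR_gt0// -natrM ler_nat; exact: grid_timeS_le.
  have h5 : k j.+1 - k j <= 16 * J j ^+ 2 * G j.
    apply: (le_trans h3).
    have -> : 16 * J j ^+ 2 * G j = 4 * J j ^+ 2 * (4 * G j) by ring.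
    rewrite ler_wpM2l ?mulr_ge0 ?exprn_ge0//.
    by have := G1 j; lra.
  apply: (@le_trans _ _ ((k j2 + 16 * J j ^+ 3) * G j)); last first.
    by rewrite ler_wpM2l ?GG// addr_ge0 ?(ltW (k_gt0 _))// mulr_ge0 ?exprn_ge0.
  apply: (@le_trans _ _ ((k j2 + 16 * (j%:R ^+ 3 + J j ^+ 2)) * G j)).
    have -> : (k j2 + 16 * (j%:R ^+ 3 + J j ^+ 2)) * G j =
      (k j2 + 16 * j%:R ^+ 3) * G j + 16 * J j ^+ 2 * G j by ring.
    lra.
  rewrite ler_wpM2r ?expR_ge0// lerD2l ler_pM2l// -(natr1 j).
  have j_ge0 : 0 <= j%:R :> R by [].
  have j2_ge0 : 0 <= j%:R ^+ 2 :> R by rewrite sqr_ge0.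
  have -> : (j%:R + 1 : R) ^+ 3 = j%:R ^+ 3 + (j%:R + 1) ^+ 2 + (2 * j%:R ^+ 2 + j%:R) by ring.
  lra.
pose C3 := ln (k j2 + 16).
have C30 : 0 <= C3 by rewrite ln_ge0//; have := k_ge1 j2; lra.
have C40 : 0 <= C2 + 2 * C3 + 10 by lra.
near=> j.
have jj : (j2 <= j)%N by near: j; exists j2.
have hs : (C2 + 2 * C3 + 10) * (ln (J j) + 1) <= eps * ln (N j).
  by near: j; exact: near_ln_small.
have t0 := lnJ_ge0 j.
have h : ln (k j) <= (C3 + 3 * ln (J j)) + (ln (N j) + C2 + 4 * ln (J j)) / (1 + s).
  have kp : 0 < k j2 + 16 by have := k_gt0 j2; lra.
  have J3 : 0 < J j ^+ 3 by rewrite exprn_gt0.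
  have -> : C3 + 3 * ln (J j) = ln ((k j2 + 16) * J j ^+ 3).
    by rewrite (lnM (kp : _ \in Num.pos) (J3 : _ \in Num.pos)) lnXn// [in LHS]mulr_natl.
  rewrite -[X in _ + X]expRK -/(G j) -lnM ?posrE ?mulr_gt0 ?expR_gt0//.
  apply: ln_le => //; apply: (le_trans (kG j jj)).
  have J3_ge1 : 1 <= J j ^+ 3 by rewrite exprn_ege1.
  have jJ3 : j%:R ^+ 3 <= J j ^+ 3 by rewrite lerXn2r ?nnegrE// ler_nat.
  have kJ : k j2 <= k j2 * J j ^+ 3 by rewrite ler_peMr// ltW.
  have -> : (k j2 + 16) * J j ^+ 3 = k j2 * J j ^+ 3 + 16 * J j ^+ 3 by ring.
  by rewrite ler_pM2r ?expR_gt0//; lra.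
rewrite -lerBlDl ler_pdivlMr// mulrBl in h.
have s12 : 1 + s = 2 - 20 * eps by rewrite /s; lra.
rewrite s12 in h.
have t3 : 0 <= C3 + 3 * ln (J j) by rewrite addr_ge0// mulr_ge0.
have h6 : (C3 + 3 * ln (J j)) * (2 - 20 * eps) <= (C3 + 3 * ln (J j)) * 2.
  by rewrite ler_wpM2l//; have := eps_gt0; lra.
have h7 : 0 <= (C2 + 2 * C3) * ln (J j) by rewrite mulr_ge0//; lra.
rewrite [(C2 + _ + _) * _]mulrDl mulrDr mulr1 in hs.
rewrite mulrC mulrDl mul1r; lra.
Unshelve. all: end_near. Qed.
End exponents.

(** * Retention times *)

Section retention.
Context {R : realType} (x : nat -> R) (M : nat) (delta : R).
Local Notation eps := (M%:R^-1 : R).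
Local Notation nj := (grid_time M).
Hypothesis M_big : (1000 <= M)%N.
Hypothesis delta_large : 46 * eps <= delta.
Hypothesis time_le : \forall j \near \oo,
  (1 - eps) * ln (nj j)%:R <= (2 + 20 * eps) * ln (kept x (nj j))%:R.
Hypothesis time_ge : \forall j \near \oo,
  (2 - 20 * eps) * ln (kept x (nj j))%:R <= (1 + eps) * ln (nj j)%:R.

Let M_gt0 : (0 < M)%N. Proof. exact: leq_trans M_big. Qed.
Let eps_gt0 : 0 < eps. Proof. by rewrite invr_gt0 ltr0n. Qed.
Let eps_small : 1000 * eps <= 1.
Proof. by rewrite ler_pdivrMr ?ltr0n// mul1r (ler_nat _ 1000). Qed.

(** Rules out [None] in [retained]: [ln] of the count is bounded below by a multiple of [ln n]. *)
Lemma kept_unbounded k : exists n, (k <= kept x n)%N.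
Proof.
have e0 := eps_gt0; have e1 := eps_small.
have [j0 _ hj0] := time_le.
have lam0 : 0 < ln (1 + eps) by rewrite ln_gt0// ltrDl.
pose j := maxn j0 (Num.truncn (3 * `|ln (k%:R : R)| / ((1 - eps) * ln (1 + eps)))).+1.
exists (nj j).
have h := hj0 j (leq_maxl _ _).
have kp : 0 < (kept x (nj j))%:R :> R by rewrite ltr0n kept_gt0 ?grid_time_gt0.
have k1 : 1 <= (kept x (nj j))%:R :> R by rewrite (ler_nat _ 1) kept_gt0 ?grid_time_gt0.
have [->//|k_gt0] := posnP k.
have c0 : 0 < (1 - eps) * ln (1 + eps) by rewrite mulr_gt0//; lra.
have hj : 3 * `|ln (k%:R : R)| <= (1 - eps) * ln (1 + eps) * j%:R.
  rewrite [leRHS]mulrC -ler_pdivrMr//; apply: (ltW (lt_le_trans (truncnS_gt _) _)).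
  by rewrite ler_nat leq_maxr.
have hg : (1 - eps) * (ln (1 + eps) * j%:R) <= (1 - eps) * ln (nj j)%:R.
  by rewrite ler_pM2l ?ln_grid_time_ge//; lra.
have lnk0 : 0 <= ln ((kept x (nj j))%:R : R) by rewrite ln_ge0.
have : ln (k%:R : R) <= ln ((kept x (nj j))%:R : R).
  have := ler_norm (ln (k%:R : R)); rewrite mulrA in hg.
  have : 20 * eps * ln (kept x (nj j))%:R <= 1 * ln (kept x (nj j))%:R.
    by rewrite ler_wpM2r//; lra.
  by move: (le_trans hj (le_trans hg h)); rewrite mulrDl mul1r; lra.
by rewrite ler_ln ?posrE ?ltr0n// ?ler_nat// kept_gt0 ?grid_time_gt0.
Qed.

(** [T_k] lies between grid times [n_i] and [n_(i+1) <= 3 n_i] whose counts surround [k]; the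
    additive 2 bounds [ln 3]. Dividing by [1 + eps] or [1 - eps] turns [20 eps] into at most
    [23 eps], hence [46 eps <= delta]. *)
Lemma retained_bounds : \forall k \near \oo, exists t s,
  [/\ retained 1 x k = Some (t, s), (0 < t)%N,
      (2 - delta / 2) * ln k%:R - 2 <= ln t%:R &
      ln t%:R <= (2 + delta / 2) * ln k%:R + 2].
Proof.
have e0 := eps_gt0; have e1 := eps_small; have e2 := delta_large.
have [j0 _ hj0] := time_le; have [j1 _ hj1] := time_ge.
exists (nj (maxn j0 j1) + 2)%N => // k/= hk.
have k0 : (0 < k)%N by clear -hk; lia.
have [n kn] := kept_unbounded k.
have [t [s [rt /andP[t0 tn] st kt]]] := retained_kept k0 kn.
have ktE : kept x t = k by rewrite /kept st.
have kle : (k <= t)%N by rewrite -ktE kept_le.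
exists t, s; split => //.
all: have ex : exists j, (t <= nj j)%N by exists t; exact/ltnW/grid_time_gt.
all: case: (ex_minnP ex) => -[|i] ti mini.
1,3: exfalso; move: ti; rewrite /grid_time; clear -hk kle; lia.
all: have it : (nj i < t)%N by
  rewrite ltnNge; apply/negP => /mini; rewrite ltnn.
all: have ij : (maxn j0 j1 <= i)%N by
  rewrite leqNgt; apply/negP => /(grid_time_nondecr M) h;
  move: (leq_trans ti h) => h2; clear -h2 hk kle; lia.
all: have N3 : ln (nj i.+1)%:R <= 2 + ln (nj i)%:R :> R by
  (apply: (@le_trans _ _ (ln (3 * (nj i)%:R)));
   [by rewrite ln_le ?ltr0n ?grid_time_gt0// -natrM ler_nat grid_timeS_le|
   rewrite lnM ?posrE ?ltr0n ?grid_time_gt0// lerD2r;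
   by have := @le_ln1Dx R 2; rewrite (_ : 1 + 2 = 3 :> R); lra]).
all: have Nt : ln (nj i)%:R <= ln t%:R :> R by
  rewrite ln_le ?ltr0n ?grid_time_gt0// ler_nat ltnW.
all: have tN : ln t%:R <= ln (nj i.+1)%:R :> R by
  rewrite ln_le ?ltr0n// ler_nat.
all: have lnk0 : 0 <= ln k%:R :> R by rewrite ln_ge0// (ler_nat _ 1).
- have h : (2 - 20 * eps) * ln (kept x (nj i.+1))%:R <= (1 + eps) * ln (nj i.+1)%:R.
    by apply: hj1; apply: leq_trans (leqW ij); exact: leq_maxr.
  have kk : ln k%:R <= ln (kept x (nj i.+1))%:R :> R.
    by rewrite ln_le ?ltr0n// ler_nat -ktE kept_nondecr.
  have h2 : (2 - 20 * eps) * ln k%:R <= (1 + eps) * (2 + ln t%:R).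
    apply: (@le_trans _ _ ((2 - 20 * eps) * ln (kept x (nj i.+1))%:R)).
      by rewrite ler_pM2l//; lra.
    apply: (le_trans h); rewrite ler_pM2l//; lra.
  have h3 : (2 - 23 * eps) * (1 + eps) * ln k%:R <= (2 - 20 * eps) * ln k%:R.
    by rewrite ler_wpM2r//; nra.
  have h4 : (2 - 23 * eps) * ln k%:R <= 2 + ln t%:R.
    rewrite -(@ler_pM2l _ (1 + eps)); last lra.
    by apply: le_trans h2; apply: le_trans h3; rewrite mulrCA mulrA.
  have h5 : (2 - delta / 2) * ln k%:R <= (2 - 23 * eps) * ln k%:R.
    by rewrite ler_wpM2r//; lra.
  lra.
- have h : (1 - eps) * ln (nj i)%:R <= (2 + 20 * eps) * ln (kept x (nj i))%:R.
    by apply: hj0; apply: leq_trans ij; exact: leq_maxl.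
  have kk : ln (kept x (nj i))%:R <= ln k%:R :> R.
    by rewrite ln_le ?ltr0n ?kept_gt0 ?grid_time_gt0// ler_nat ltnW// kt.
  have h2 : (1 - eps) * ln (nj i)%:R <= (2 + 20 * eps) * ln k%:R.
    by apply: (le_trans h); rewrite ler_pM2l//; lra.
  have h3 : (2 + 20 * eps) * ln k%:R <= (1 - eps) * (2 + 23 * eps) * ln k%:R.
    by rewrite ler_wpM2r//; nra.
  have h4 : ln (nj i)%:R <= (2 + 23 * eps) * ln k%:R.
    rewrite -(@ler_pM2l _ (1 - eps)); last lra.
    by apply: (le_trans h2); rewrite mulrA.
  have h5 : (2 + 23 * eps) * ln k%:R <= (2 + delta / 2) * ln k%:R.
    by rewrite ler_wpM2r//; lra.
  lra.
Qed.
End retention.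

Lemma near_le_ln_nat {R : realType} (T : R) : \forall k \near \oo, T <= ln k%:R.
Proof.
near=> k; rewrite -[T]expRK ln_le ?expR_gt0//.
by near: k; exact: near_le_nat.
Unshelve. all: end_near. Qed.

Lemma retention_time_limits {R : realType} (x : nat -> R) (delta : R) : 0 < delta ->
  (\forall k \near \oo, exists t s,
  [/\ retained 1 x k = Some (t, s), (0 < t)%N,
      (2 - delta / 2) * ln k%:R - 2 <= ln t%:R &
      ln t%:R <= (2 + delta / 2) * ln k%:R + 2]) ->
  ((retention_time 1 x k * ((k%:R `^ (2 - delta))^-1)%:E)%E
       @[k --> \oo] --> +oo%E) /\
  ((retention_time 1 x k * ((k%:R `^ (2 + delta))^-1)%:E)%E
       @[k --> \oo] --> 0%E).
Proof.
move=> d0 hx; split.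
- apply/cvgeyPge => A; near=> k.
  have [t [s [rt t0 h _]]] : exists t s,
    [/\ retained 1 x k = Some (t, s), (0 < t)%N,
      (2 - delta / 2) * ln k%:R - 2 <= ln t%:R &
      ln t%:R <= (2 + delta / 2) * ln k%:R + 2] by near: k.
  have k0 : (0 < k)%N by near: k; exists 1%N.
  have kR : 0 < k%:R :> R by rewrite ltr0n.
  have tR : 0 < t%:R :> R by rewrite ltr0n.
  rewrite /retention_time rt -EFinM lee_fin /powR gt_eqF// -expRN.
  rewrite -[t%:R]lnK ?posrE// -expRD.
  have hk : 2 * (`|A| + 2) / delta <= ln k%:R by near: k; exact: near_le_ln_nat.
  rewrite ler_pdivrMr// in hk.
  apply: (le_trans (ler_norm A)); apply: le_trans (expR_ge1Dx _).
  rewrite mulrBl in h; rewrite mulrBl; lra.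
- apply: (@squeeze_cvge _ _ _ _ (cst 0%E) _ (fun k => (expR (2 - delta / 2 * ln k%:R))%:E)).
  + near=> k.
    have [t [s [rt t0 _ h]]] : exists t s,
      [/\ retained 1 x k = Some (t, s), (0 < t)%N,
      (2 - delta / 2) * ln k%:R - 2 <= ln t%:R &
      ln t%:R <= (2 + delta / 2) * ln k%:R + 2] by near: k.
    have k0 : (0 < k)%N by near: k; exists 1%N.
    have kR : 0 < k%:R :> R by rewrite ltr0n.
    have tR : 0 < t%:R :> R by rewrite ltr0n.
    rewrite /retention_time rt -EFinM !lee_fin /powR gt_eqF// -expRN.
    rewrite -[t%:R]lnK ?posrE// -expRD expR_ge0/= ler_expR.
    rewrite mulrDl in h; rewrite mulrDl; lra.
  + exact: cvg_cst.
  + apply: cvg_EFin; first exact: nearW.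
    apply/cvgrPdist_le => e e0; near=> k.
    rewrite /= sub0r normrN ger0_norm ?expR_ge0//.
    rewrite -[e]lnK ?posrE// ler_expR.
    have hk : 2 * (2 - ln e) / delta <= ln k%:R by near: k; exact: near_le_ln_nat.
    rewrite ler_pdivrMr// in hk; lra.
Unshelve. all: end_near. Qed.

(** * Counting independent exceedances *)

Section counting.
Context {d : measure_display} {T : measurableType d} {R : realType}
  (P : probability T R).

Lemma measurable_count_dev (I : nat -> set T) (u t : R) (n : nat) :
  (forall i, measurable (I i)) ->
  measurable [set w | (t <= `|\sum_(1 <= i < n.+1) \1_(I i) w - u|)%R].
Proof.
move=> mI; pose S w : R := \sum_(1 <= i < n.+1) \1_(I i) w.
have mS : measurable_fun setT S.
  by apply: measurable_sum => i; exact: measurable_indic.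
have -> : [set w | (t <= `|\sum_(1 <= i < n.+1) \1_(I i) w - u|)%R] =
    (fun w => `|S w - u|) @^-1` `[t, +oo[.
  by apply/seteqP; split => w; rewrite /= in_itv/= andbT.
rewrite -[X in measurable X]setTI; apply: measurableT_comp => //.
exact: measurable_funB.
Qed.

Lemma count_chebyshev (I : nat -> set T) (p t : R) (n : nat) :
  (forall i, measurable (I i)) -> 0 <= p -> 0 < t ->
  (forall i, (0 < i)%N -> P (I i) = p%:E) ->
  (forall i j, (0 < i)%N -> (0 < j)%N -> i != j -> P (I i `&` I j) = (p ^+ 2)%:E) ->
  (P [set w | (t <= `|\sum_(1 <= i < n.+1) \1_(I i) w - n%:R * p|)%R] <=
   (n%:R * p / t ^+ 2)%:E)%E.
Proof.
move=> mI p0 t0 PI PIJ.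
pose S w : R := \sum_(1 <= i < n.+1) \1_(I i) w.
pose np := n%:R * p; pose q w := (S w - np) ^+ 2.
have np0 : 0 <= np by rewrite mulr_ge0.
have mS : measurable_fun setT S.
  by apply: measurable_sum => i; exact: measurable_indic.
have mq : measurable_fun setT q.
  by apply: measurable_funX; apply: measurable_funB.
have S0 w : 0 <= S w by apply: sumr_ge0 => i _; rewrite indicE.
have mI1 i : measurable_fun setT (fun w => (\1_(I i) w : R)%:E).
  by apply/measurable_EFinP; exact: measurable_indic.
have ES : (\int[P]_w (S w)%:E = (n%:R * p)%:E)%E.
  rewrite /S; under eq_integral do rewrite -sumEFin.
  rewrite ge0_integral_sum//.
  rewrite (eq_big_nat _ _ (F2 := fun=> p%:E)); last first.
    by move=> i /andP[i0 _]; rewrite integral_indic// setIT; exact: PI.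
  by rewrite sumEFin sumr_const_nat subSS subn0 mulr_natl.
have ES2 : (\int[P]_w (S w ^+ 2)%:E <= (np + np ^+ 2)%:E)%E.
  have -> : (fun w => (S w ^+ 2)%:E) = (fun w =>
      \sum_(1 <= i < n.+1) \sum_(1 <= j < n.+1) (\1_(I i `&` I j) w : R)%:E)%E.
    apply/funext => w; rewrite expr2 /S mulr_suml -sumEFin.
    apply: eq_bigr => i _; rewrite mulr_sumr -sumEFin; apply: eq_bigr => j _.
    by rewrite indicI.
  have mIJ i j : measurable_fun setT (fun w => (\1_(I i `&` I j) w : R)%:E).
    by apply/measurable_EFinP; apply: measurable_indic; exact: measurableI.
  rewrite ge0_integral_sum//; last 2 first.
    by move=> i; apply: emeasurable_sum.
    by move=> i w _; apply: sume_ge0.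
  rewrite (eq_big_nat _ _ (F2 := fun i => \sum_(1 <= j < n.+1) (if j == i then p else p ^+ 2)%:E)%E); last first.
    move=> i /andP[i0 _]; rewrite ge0_integral_sum//; apply: eq_big_nat => j /andP[j0 _].
    rewrite integral_indic ?setIT//; last exact: measurableI.
    have [->|ji] := eqVneq j i; first by rewrite setIid; exact: PI.
    by apply: PIJ => //; rewrite eq_sym.
  under eq_bigr do rewrite sumEFin; rewrite sumEFin lee_fin.
  have h i : \sum_(1 <= j < n.+1) (if j == i then p else p ^+ 2) <= p + n%:R * p ^+ 2.
    apply: (@le_trans _ _ (\sum_(1 <= j < n.+1) ((if j == i then p else 0) + p ^+ 2))).
      apply: ler_sum => j _; case: ifP => _; last by rewrite add0r.
      by rewrite lerDl sqr_ge0.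
    rewrite big_split/= sumr_const_nat subSS subn0 mulr_natl lerD2r.
    rewrite -big_mkcond/= big_const_seq iter_addr_0.
    by rewrite (count_uniq_mem i (iota_uniq _ _)); case: (_ \in _).
  apply: (@le_trans _ _ (\sum_(1 <= i < n.+1) (p + n%:R * p ^+ 2))).
    by apply: ler_sum => i _; exact: h.
  rewrite sumr_const_nat subSS subn0 -[leLHS]mulr_natl le_eqVlt; apply/orP; left.
  by apply/eqP; rewrite /np; ring.
have Eq : (\int[P]_w (q w)%:E <= np%:E)%E.
  (* The square is expanded as [(S - np)^2 + 2 np S = S^2 + np^2]: all terms are nonnegative, so the
     integrals split without integrability conditions. *)
  have e : (\int[P]_w (q w)%:E + \int[P]_w ((2 * np)%:E * (S w)%:E) =
     \int[P]_w (S w ^+ 2)%:E + \int[P]_w (cst (np ^+ 2)%:E w))%E.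
    rewrite -ge0_integralD//; last 4 first.
      by move=> w _; rewrite lee_fin sqr_ge0.
      by apply/measurable_EFinP.
      by move=> w _; rewrite -EFinM lee_fin !mulr_ge0.
      by apply: emeasurable_funM => //; apply/measurable_EFinP.
    rewrite -ge0_integralD//; last 3 first.
      by move=> w _; rewrite lee_fin sqr_ge0.
      by apply/measurable_EFinP; exact: measurable_funX.
      by move=> w _; rewrite lee_fin sqr_ge0.
    apply: eq_integral => w _; rewrite /= -EFinM -!EFinD /q; congr EFin; ring.
  rewrite integral_cst// [X in (_ * X)%E](_ : _ = 1%E) ?mule1 in e; last exact: probability_setT.
  have mSE : measurable_fun setT (fun w => (S w)%:E) by apply/measurable_EFinP.
  have S0E w : setT w -> (0 <= (S w)%:E)%E by move=> _; rewrite lee_fin.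
  have k0 : (0 <= (2 * np)%:E)%E by rewrite lee_fin mulr_ge0.
  rewrite (ge0_integralZl P measurableT mSE S0E k0) ES -EFinM in e.
  have h : (\int[P]_w (q w)%:E + (2 * np * np)%:E <= (np + 2 * np * np)%:E)%E.
    rewrite e; apply: (le_trans (leeD2r _ ES2)); rewrite -EFinD lee_fin; lra.
  by rewrite -(leeD2rE _ _ (_ : (2 * np * np)%:E \is a fin_num))// -EFinD.
pose A := [set w | t <= `|S w - np|].
have mA : measurable A by exact: measurable_count_dev.
have : ((t ^+ 2)%:E * P A <= np%:E)%E.
  apply: le_trans Eq.
  have mAE : measurable_fun setT (fun w => (\1_A w : R)%:E).
    by apply/measurable_EFinP; exact: measurable_indic.
  have A0E w : setT w -> (0 <= (\1_A w : R)%:E)%E by move=> _; rewrite lee_fin indicE.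
  have t2 : (0 <= (t ^+ 2)%:E)%E by rewrite lee_fin sqr_ge0.
  rewrite -[A in P A]setIT -(integral_indic P measurableT mA).
  rewrite -(ge0_integralZl P measurableT mAE A0E t2).
  apply: ge0_le_integral => //.
  - by move=> w _; rewrite -EFinM lee_fin mulr_ge0 ?sqr_ge0// indicE.
  - exact: emeasurable_funM.
  - by apply/measurable_EFinP.
  move=> w _; rewrite -EFinM lee_fin indicE.
  have [|_] := boolP (w \in A); last by rewrite mulr0 sqr_ge0.
  rewrite inE /A/= mulr1 => h; rewrite /q -[leRHS]real_normK ?num_real//.
  by rewrite lerXn2r ?nnegrE// ltW.
have PAf : P A \is a fin_num := fin_num_measure P A mA.
rewrite -/A -(fineK PAf) -EFinM !lee_fin => h.
by rewrite ler_pdivlMr ?exprn_gt0// mulrC.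
Qed.

Lemma borel_cantelli_near (F : nat -> set T) :
  (forall j, measurable (F j)) -> P (F 0%N) = 0%E ->
  (forall j, (0 < j)%N -> (P (F j) <= ((j%:R : R) ^- 2)%:E)%E) ->
  {ae P, forall w, \forall j \near \oo, ~ F j w}.
Proof.
move=> mF F0 hF.
(* Telescoping, by [1 / (n + 1)^2 <= 2 / (n + 1) - 2 / (n + 2)]. *)
have sum_le n : (\sum_(0 <= j < n.+1) P (F j) <= (2 - 2 * n.+1%:R^-1)%:E)%E.
  elim: n => [|n IH].
    by rewrite big_nat1 F0 lee_fin invr1; lra.
  rewrite big_nat_recr//=; apply: (le_trans (leeD IH (hF n.+1 isT))).
  rewrite -EFinD lee_fin -!natr1; set u : R := n%:R.
  have u0 : 0 <= u by [].
  have -> : (u + 1) ^- 2 = (u + 1)^-1 * (u + 1)^-1 by rewrite expr2 invfM.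
  have e : 2 * (u + 1)^-1 - 2 * (u + 1 + 1)^-1 = 2 * ((u + 1)^-1 * (u + 1 + 1)^-1).
    by field; rewrite !gt_eqF//; lra.
  have h : (u + 1)^-1 <= 2 * (u + 1 + 1)^-1.
    rewrite ler_pdivlMr; last lra.
    rewrite mulrC ler_pdivrMr; lra.
  have i0 : 0 <= (u + 1)^-1 by rewrite invr_ge0; lra.
  have := ler_wpM2l i0 h; lra.
have fin : (\sum_(0 <= j <oo) P (F j) < +oo)%E.
  apply: (@le_lt_trans _ _ 2%:E); last exact: ltry.
  apply: lime_le; first exact: is_cvg_nneseries.
  exists 1%N => // -[//|n] _ /=; apply: (le_trans (sum_le n)).
  by rewrite lee_fin gerBl mulr_ge0.
have L0 := lim_sup_set_cvg0 mF fin.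
exists (lim_sup_set F); split => //.
  apply: bigcapT_measurable => n; exact: bigcup_measurable.
move=> w /= nw n _; apply: contrapT => h; apply: nw.
exists n => // j nj Fj; apply: h; by exists j.
Qed.
End counting.

(** * The hazard function *)

Lemma abs_continuous_continuous {R : realType} (F : R -> R) :
  abs_continuous_on [set: R] F -> continuous F.
Proof.
move=> acF x; apply/cvgrPdist_lt => e e0.
have [r r0 hr] := acF e e0.
near=> z.
have zx : `|x - z| < r by near: z; apply/nbhs_ballP; exists r.
have tri (u v : R) : trivIset [set: 'I_1] (fun=> `]u, v[%classic).
  by move=> i j _ _ _; rewrite !ord1.
have [xz|/ltW zx'] := leP x z.
  have := hr 1%N (fun=> x) (fun=> z) (fun=> xz) (fun _ _ _ => I) (tri _ _).
  rewrite !big_ord1 distrC; apply.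
  by rewrite -(ger0_norm (_ : 0 <= z - x)) ?subr_ge0// distrC.
have := hr 1%N (fun=> z) (fun=> x) (fun=> zx') (fun _ _ _ => I) (tri _ _).
rewrite !big_ord1; apply.
by rewrite -(ger0_norm (_ : 0 <= x - z)) ?subr_ge0.
Unshelve. all: end_near. Qed.

Section hazard.
Context {R : realType} {d : measure_display} {T : measurableType d}
  (P : probability T R) (X0 : {RV P >-> R}) (F : R -> R).
Hypothesis X_cdf : forall x, cdf X0 x = (F x)%:E.
Hypothesis F_ac : abs_continuous_on [set: R] F.
Hypothesis F_lt1 : forall x, 0 < 1 - F x.

Lemma cdf_real_nondecr u v : u <= v -> F u <= F v.
Proof. by move=> uv; rewrite -lee_fin -!X_cdf; exact: cdf_nondecreasing. Qed.

Lemma cum_hazard_nondecr u v : u <= v -> cum_hazard F u <= cum_hazard F v.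
Proof.
by move=> uv; rewrite lerN2 ln_le// lerD2l lerN2 cdf_real_nondecr.
Qed.

Lemma cdf_attains v : 0 < v < 1 -> exists y, F y = v.
Proof.
move=> /andP[v0 v1].
have FE : cdf X0 = EFin \o F by apply/funext => x; exact: X_cdf.
have Fy : F x @[x --> +oo] --> (1 : R).
  by have := cvg_cdfy1 X0; rewrite FE => /fine_cvgP[_].
have FNy : F x @[x --> -oo] --> (0 : R).
  by have := cvg_cdfNy0 X0; rewrite FE => /fine_cvgP[_].
have [b vb] : exists b, v < F b.
  have : \forall x \near +oo, v < F x by exact: (cvgr_gt _ Fy).
  by move=> /filter_ex.
have [a va] : exists a, F a < v.
  have : \forall x \near -oo, F x < v by exact: (cvgr_lt _ FNy).
  by move=> /filter_ex.
have ab : a <= b.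
  rewrite leNgt; apply/negP => /ltW /cdf_real_nondecr.
  by rewrite leNgt (lt_trans va vb).
have [||y _ yv] := @IVT R F a b v ab.
- by apply: continuous_subspaceT; exact: abs_continuous_continuous.
- by rewrite min_l ?max_r ?cdf_real_nondecr// !ltW.
by exists y.
Qed.

(** Continuity of [F] lets the levels have tail probability exactly [exp (- a e)]. Index 0 is left
    out, as [F] need not take the value 0. *)
Lemma hazard_grid (e : R) : 0 < e -> exists y : nat -> R,
  forall a, (0 < a)%N ->
    F (y a) = 1 - expR (- (a%:R * e)) /\ cum_hazard F (y a) = a%:R * e.
Proof.
move=> e0; have /choice[y hy] (a : nat) : exists y, (0 < a)%N ->
    F y = 1 - expR (- (a%:R * e)).
  have [->|a0] := posnP a; first by exists 0.
  have [|y hy] := @cdf_attains (1 - expR (- (a%:R * e))).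
    rewrite subr_gt0 expR_lt1 oppr_lt0 mulr_gt0 ?ltr0n//=.
    by rewrite gtrBl expR_gt0.
  by exists y.
exists y => a a0; split; first exact: hy.
by rewrite /cum_hazard hy// subKr expRK opprK.
Qed.
End hazard.

Lemma stretched_exp_hazard {R : realType} (alpha : R) (F : R -> R) :
  gen_stretched_exp alpha F -> exists (x0 : R) (dH : R -> R),
  (forall t, x0 < t -> is_derive t 1 (cum_hazard F) (dH t)) /\
  (dH t / t `^ (alpha - 1)) @[t --> +oo] --> alpha.
Proof.
move=> [x0 x0_ge0 [_ [h [Hh dh _ hlim]]]].
exists x0, (fun t => alpha * t `^ (alpha - 1) + derive1 h t); split.
  move=> t xt; have t0 : 0 < t := le_lt_trans x0_ge0 xt.
  have dp := is_derive1_powR alpha t0.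
  have dht : is_derive t 1 h (derive1 h t).
    have [dht _] := dh t xt; rewrite derive1E; exact: derivableP.
  have ds : is_derive t 1 (fun x => x `^ alpha + h x)
      (alpha * t `^ (alpha - 1) + derive1 h t) by exact: is_deriveD.
  have nE : \forall x \near t, x `^ alpha + h x = cum_hazard F x.
    by near=> x; rewrite Hh//; near: x; exact: lt_nbhsr.
  case: ds => ds1 ds2; split.
    apply: (@near_eq_derivable _ _ _ (fun x => x `^ alpha + h x)) => //.
  rewrite -ds2; apply: (@near_eq_derive _ _ _ (cum_hazard F)) => //.
  by near=> x; apply/esym; near: x.
have : alpha + derive1 h t / t `^ (alpha - 1) @[t --> +oo] --> alpha + 0.
  by apply: cvgD hlim; exact: cvg_cst.
rewrite addr0; apply: cvg_trans; apply: near_eq_cvg; near=> t.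
have t0 : 0 < t by near: t; exact: nbhs_pinfty_gt.
by rewrite mulrDl mulfK// gt_eqF// powR_gt0.
Unshelve. all: end_near. Qed.

Theorem corollary5p1 (R : realType) (d : measure_display)
    (T : measurableType d) (P : probability T R) (X : nat -> {RV P >-> R})
    (F : R -> R) (alpha : R)
    (X_indep : independent_RVs [set i | (0 < i)%N] X)
    (X_cdf : forall i, (0 < i)%N -> forall x, cdf (X i) x = (F x)%:E)
    (F_ac : abs_continuous_on [set: R] F)
    (F_lt1 : forall x, 0 < 1 - F x)
    (alpha_gt0 : 0 < alpha)
    (F_G : gen_stretched_exp alpha F)
    (delta : R) (delta_gt0 : 0 < delta) :
  {ae P, forall w,
    ((retention_time 1 (fun i => X i w) k * ((k%:R `^ (2 - delta))^-1)%:E)%E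
       @[k --> \oo] --> +oo%E) /\
    ((retention_time 1 (fun i => X i w) k * ((k%:R `^ (2 + delta))^-1)%:E)%E
       @[k --> \oo] --> 0%E)}.
Proof.
(* The second argument gives [46 / M <= delta]; 1000 is the smallness of [eps] that the numerical
   estimates assume. *)
pose M := maxn 1000 (Num.truncn (46 / delta)).+1.
have M_big : (1000 <= M)%N by exact: leq_maxl.
have M0 : 0 < M%:R :> R by rewrite ltr0n (leq_trans _ M_big).
pose eps : R := M%:R^-1.
have e0 : 0 < eps by rewrite invr_gt0.
have e1 : eps < 1 by rewrite invf_lt1// (ltr_nat _ 1) (leq_trans _ M_big).
have eps_delta : 46 * eps <= delta.
  rewrite ler_pdivrMr// mulrC -ler_pdivrMr//.
  by apply: (le_trans (ltW (truncnS_gt _))); rewrite ler_nat leq_maxr.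
have [x0 [dH [dHP dHlim]]] := stretched_exp_hazard F_G.
have e01 : 0 < eps < 1 by rewrite e0 e1.
have [m_ hm] := excess_bounds alpha_gt0 e01 dHP dHlim.
have [y hy] := hazard_grid (X_cdf 1%N isT) F_ac e0.
have Hnd := cum_hazard_nondecr (X_cdf 1%N isT) F_lt1.
pose I a i := X i @^-1` `]y a, +oo[%classic.
have mI a i : measurable (I a i).
  by rewrite /I -[X in measurable X]setTI; exact: measurable_funPT.
pose p a : R := expR (- (a%:R * eps)).
have PI a i : (0 < a)%N -> (0 < i)%N -> P (I a i) = (p a)%:E.
  move=> a0 i0; have := ccdf_1_cdf (X i) (y a).
  by rewrite X_cdf// (hy a a0).1 -EFinB subKr.
have PIJ a i j : (0 < a)%N -> (0 < i)%N -> (0 < j)%N -> i != j ->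
    P (I a i `&` I a j) = (p a ^+ 2)%:E.
  move=> a0 i0 j0 ij.
  have := @X_indep [fset i; j]%fset (fun=> `]y a, +oo[%classic).
  move=> /(_ _ _)h; have {}h := h _ _.
  have {h} : P (\bigcap_(k in [set` [fset i; j]%fset]) (X k @^-1` `]y a, +oo[%classic)) =
     (\prod_(k <- [fset i; j]%fset) P (X k @^-1` `]y a, +oo[%classic))%E.
    apply: h; last by move=> k; exact: measurable_itv.
    by move=> k /=; rewrite in_fset2 => /orP[]/eqP ->.
  rewrite big_fsetU1 ?in_fset1//= big_seq_fset1 !(PI a)// expr2 EFinM => <-.
  congr (P _); apply/seteqP; split => w /=.
    by move=> [wi wj] k /=; rewrite in_fset2 => /orP[]/eqP ->.
  by move=> h; split; apply: h => /=; rewrite in_fset2 eqxx ?orbT.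
(* The count at level [a] has variance at most [n p a], and [t j a] is [j^2] times the square root
   of this. Chebyshev gives [j^-4] per level, and the union over [j^2] levels the summable
   [j^-2]. *)
pose t j a : R := j%:R ^+ 2 * Num.sqrt (grid_time M j)%:R * expR (- (a%:R * eps) / 2).
pose bad j a := [set w | (t j a <= `|\sum_(1 <= i < (grid_time M j).+1) \1_(I a i) w -
   (grid_time M j)%:R * p a|)%R].
have mbad j a : measurable (bad j a) by exact: measurable_count_dev.
pose B j := \big[setU/set0]_(a < j ^ 2) bad j a.+1.
have mB j : measurable (B j) by apply: bigsetU_measurable.
have B0 : P (B 0%N) = 0%E by rewrite /B exp0n// big_ord0 measure0.
have PB j : (0 < j)%N -> (P (B j) <= ((j%:R : R) ^- 2)%:E)%E.
  move=> j0; have jR : 0 < j%:R :> R by rewrite ltr0n.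
  have N0 : 0 < (grid_time M j)%:R :> R by rewrite ltr0n grid_time_gt0.
  have := @Boole_inequality _ R T P (fun a => bad j a.+1) (j ^ 2) (fun i _ => mbad j i.+1).
  move=> /le_trans; apply.
  apply: (@le_trans _ _ (\sum_(a < j ^ 2) ((j%:R : R) ^- 4)%:E)%E).
    apply: lee_sum => a _; have t0 : 0 < t j a.+1.
      by rewrite !mulr_gt0 ?expR_gt0 ?sqrtr_gt0 ?exprn_gt0.
    have := count_chebyshev (grid_time M j) (mI a.+1) (expR_ge0 _) t0
      (fun i i0 => PI a.+1 i isT i0) (fun i k i0 k0 ik => PIJ a.+1 i k isT i0 k0 ik).
    move=> /le_trans; apply.
    rewrite lee_fin le_eqVlt; apply/orP; left; apply/eqP.
    rewrite /t !exprMn sqr_sqrtr ?(ltW N0)//.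
    have -> : expR (- (a.+1%:R * eps) / 2) ^+ 2 = p a.+1.
      by rewrite expr2 -expRD -splitr.
    have := expR_gt0 (- (a.+1%:R * eps)); rewrite /p; set E := expR _ => E0.
    by field; rewrite !gt_eqF.
  rewrite sumEFin sumr_const card_ord lee_fin -[leLHS]mulr_natl natrX.
  rewrite le_eqVlt; apply/orP; left; apply/eqP; field; by rewrite gt_eqF.
apply: filterS (borel_cantelli_near mB B0 PB) => w hw.
apply: retention_time_limits delta_gt0 _.
pose xw i := X i w.
have good : \forall j \near \oo, forall a, (0 < a <= j ^ 2)%N ->
  `|(exceed xw y (grid_time M j) a)%:R -
    (grid_time M j)%:R * expR (- (a%:R * eps))| <=
  j%:R ^+ 2 * Num.sqrt (grid_time M j)%:R * expR (- (a%:R * eps) / 2).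
  near=> j => -[//|a] /= aj; rewrite leNgt; apply/negP => /ltW h.
  have : ~ B j w by near: j; exact: hw.
  have -> : B j = \bigcup_(i in `I_(j ^ 2)) bad j i.+1 by rewrite bigcup_mkord.
  apply; exists a => //.
  move: h; rewrite /bad/= /exceed natr_sum => /le_trans; apply.
  rewrite le_eqVlt; apply/orP; left; apply/eqP; congr (`|_ - _|).
  apply: eq_bigr => i _; rewrite indicE.
  suff -> : (w \in I a.+1 i) = (y a.+1 < xw i) by [].
  by apply/idP/idP; rewrite inE /I /xw/= in_itv/= andbT.
have Hy a : (0 < a)%N -> cum_hazard F (y a) = a%:R * eps by move=> /hy[].
have facts := block_facts M_big Hnd Hy hm good.
have k1 j : 1 <= (kept xw (grid_time M j))%:R :> R.
  by rewrite (ler_nat _ 1) kept_gt0// grid_time_gt0.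
have kk j : (kept xw (grid_time M j))%:R <= (kept xw (grid_time M j.+1))%:R :> R.
  by rewrite ler_nat kept_nondecr// ltnW// grid_time_incr.
have kN j : (kept xw (grid_time M j))%:R <= (grid_time M j)%:R :> R.
  by rewrite ler_nat kept_le.
have h1 := ln_time_le M_big k1 kk facts.
have h2 := ln_time_ge M_big k1 kN facts.
exact: retained_bounds M_big eps_delta h1 h2.
Unshelve. all: end_near. Qed.
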